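(* Let $f(z)=\sum_{k=0}^{\infty}f_kz^{k}$ be a power series with positive radius of convergence. Let $a>0$, $t>0$, let $x$ be complex, and let $b,\beta$ be complex with $0<\operatorname{Re}(\beta)<\operatorname{Re}(b)$. Then $$\sum_{k=0}^{\infty}f_{k}\,t^{b+k-1}E_{a,b+k}\left(xt^{a}\right)=\int_{0}^{t}(t-u)^{b-\beta-1}E_{a,b-\beta}\left(x(t-u)^{a}\right)u^{\beta-1}\sum_{k=0}^{\infty}f_{k}\frac{u^{k}}{\Gamma(\beta+k)}\,du .$$
   Context: The Mittag-Leffler function is $E_{a,b}(z)=\sum_{k=0}^{\infty}\frac{z^{k}}{\Gamma(b+ak)}$ for $\operatorname{Re}(a)>0$, with $1/\Gamma$ the entire reciprocal Gamma function. *)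

(* Defs.v *)
From Stdlib Require Import Reals ZArith Lra Lia.
From Coquelicot Require Import Coquelicot.
Open Scope R_scope.

(* t^z = exp (z ln t) with the real logarithm; only meaningful for 0 < t,
   since [ln] is the junk value 0 elsewhere. *)
Definition Rpowc (t : R) (z : C) : C :=
  (exp (Re z * ln t) * cos (Im z * ln t),
   exp (Re z * ln t) * sin (Im z * ln t)).

(* Sum of a complex series; unspecified when the series diverges. *)
Definition CSeries (a : nat -> C) : C :=
  iota (T := C_CompleteNormedModule) (is_series (V := C_NormedModule) a).

(* Euler's integral, improper at both ends; only meaningful for 0 < Re z. *)
Definition Gamma (z : C) : C :=
  RInt_gen (V := C_R_CompleteNormedModule)
    (fun u : R => (Rpowc u (z - 1) * exp (- u))%C)
    (at_right 0) (Rbar_locally p_infty).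

Fixpoint rising (z : C) (n : nat) : C :=
  match n with
  | O => 1%C
  | S m => (rising z m * (z + INR m))%C
  end.

(* The entire function 1/Gamma, extended from the half-plane 0 < Re z by
   1/Gamma(z) = z (z+1) ... (z+n-1) / Gamma(z+n).  The shift n is the least
   natural number with 0 < Re z + n ([up r] is the least integer above r), so
   n = 0 on the half-plane, and the product contains the factor 0 exactly when
   z is a nonpositive integer. *)
Definition rGamma (z : C) : C :=
  let n := Z.to_nat (up (- Re z)) in
  (rising z n / Gamma (z + INR n))%C.

Lemma rGamma_Re_pos (z : C) : 0 < Re z -> rGamma z = (/ Gamma z)%C.
Proof.
  intros Hz.
  assert (Hn : Z.to_nat (up (- Re z)) = 0%nat).
  { destruct (archimed (- Re z)) as [_ H].
    assert (Hlt : IZR (up (- Re z)) < 1) by lra.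
    apply lt_IZR in Hlt. lia. }
  unfold rGamma. rewrite Hn. simpl rising. simpl INR.
  replace (z + RtoC 0)%C with z by ring.
  unfold Cdiv. ring.
Qed.

Definition MittagLeffler (a b z : C) : C :=
  CSeries (fun k : nat => (z ^ k * rGamma (b + a * INR k))%C).

(* Main.v *)
Require Import Defs.
From Stdlib Require Import Reals Lra Lia.
From Coquelicot Require Import Coquelicot.
Open Scope R_scope.

(** Write p = b - beta.  The integrand is the weight (t-u)^(p-1) u^(beta-1)
    times two power-type series: the Mittag-Leffler series, with terms
    (x (t-u)^a)^j / Gamma(p+aj), and the series with terms
    f_k u^k / Gamma(beta+k).  On (0, t) both have summable majorants
    independent of u, because 1/Gamma decays faster than every geometric
    sequence along an arithmetic progression ([rGamma_summable]), and the
    weight is absolutely integrable.  Both series may therefore be integrated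
    term by term ([Cint_series]), and each term is a Beta integral
      int_0^t (t-u)^(p+aj-1) u^(beta+k-1) du
        = t^(b+k+aj-1) Gamma(p+aj) Gamma(beta+k) / Gamma(b+k+aj)
    ([Cint_Beta_Gamma]).  Summing over j first gives t^(b+k-1) times
    E_{a,b+k}(x t^a) ([Cint_ML]); summing over k then gives the left-hand side.

    Three facts about the complex Gamma function carry the argument.

    The relation between Beta and Gamma ([Beta_Gamma]) is obtained from limits
    instead of a double integral.  As m grows, the integrals of
    (1-v/m)^(q+m) v^(p-1) over (0, m) tend to Gamma(p) ([Beta_approx]); they
    are m^p B(q+m+1, p), and integration by parts expresses them by B(q, p) and
    rising factorials.  This gives product formulas for Gamma(p), Gamma(q) and
    Gamma(p+q) that combine to B(q, p) Gamma(p+q) = Gamma(p) Gamma(q).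

    A lower bound for |Gamma(c+iy)| with c large against y^2
    ([Cmod_Gamma_ge]): the density u^(c-1) e^(-u) is so concentrated around
    u = c that the oscillating factor u^(iy) cannot cancel more than half of
    its mass.  With the functional equation this also shows that Gamma has no
    zero in the right half-plane ([Gamma_neq_0]).

    The growth of Gamma on the real axis ([GammaR_growth]): for every m,
    Gamma(c) exceeds a fixed multiple of m^c once c is large. *)

Lemma C_ext (z w : C) : Re z = Re w -> Im z = Im w -> z = w.
Proof. destruct z, w; simpl; intros -> ->; reflexivity. Qed.

Lemma Re_plus (z w : C) : Re (z + w) = Re z + Re w.
Proof. reflexivity. Qed.

Lemma Im_plus (z w : C) : Im (z + w) = Im z + Im w.
Proof. reflexivity. Qed.

Lemma Re_minus (z w : C) : Re (z - w) = Re z - Re w.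
Proof. reflexivity. Qed.

Lemma Im_minus (z w : C) : Im (z - w) = Im z - Im w.
Proof. reflexivity. Qed.

Lemma Im_le_Cmod (z : C) : Rabs (Im z) <= Cmod z.
Proof.
  generalize (sqrt_plus_sqr (Re z) (Im z)).
  unfold Cmod, Re, Im. generalize (Rmax_r (Rabs (fst z)) (Rabs (snd z))). lra.
Qed.

Lemma Cmod_le_Re_Im (z : C) : Cmod z <= Rabs (Re z) + Rabs (Im z).
Proof.
  replace z with ((Re z : C) + (0, Im z))%C at 1
    by (apply C_ext; simpl; ring).
  eapply Rle_trans; [apply Cmod_triangle|].
  rewrite Cmod_R. apply Rplus_le_compat_l.
  unfold Cmod. simpl. replace (0 * (0 * 1) + Im z * (Im z * 1)) with (Rsqr (Im z))
    by (unfold Rsqr; ring).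
  rewrite sqrt_Rsqr_abs. apply Rle_refl.
Qed.

Lemma norm_C_R (z : C) : norm (V := C_R_NormedModule) z = Cmod z.
Proof.
  unfold norm, Cmod. simpl. unfold prod_norm, norm, Cmod. simpl.
  unfold abs; simpl. f_equal.
  rewrite !Rmult_1_r, <- !Rabs_mult, !Rabs_pos_eq by nra. ring.
Qed.

(** * Improper integrals over (0, T) *)

(** A single parameter T covers both the Gamma integral, T = +oo, and the
    integrals over a bounded interval. *)
Definition left_of (T : Rbar) : (R -> Prop) -> Prop :=
  match T with Finite t => at_left t | _ => Rbar_locally T end.

Definition inside (T : Rbar) (u : R) : Prop := 0 < u /\ Rbar_lt u T.

Definition Rint (f : R -> R) (T : Rbar) (l : R) : Prop :=
  is_RInt_gen f (at_right 0) (left_of T) l.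

Definition Cint (f : R -> C) (T : Rbar) (l : C) : Prop :=
  is_RInt_gen (V := C_R_NormedModule) f (at_right 0) (left_of T) l.

Global Instance left_of_proper (T : Rbar) : ProperFilter (left_of T).
Proof.
  destruct T; unfold left_of.
  - apply at_left_proper_filter.
  - apply (Rbar_locally_filter p_infty).
  - apply (Rbar_locally_filter m_infty).
Qed.

Lemma inside_between T a b u :
  inside T a -> inside T b -> a <= u <= b -> inside T u.
Proof.
  intros [Ha _] [_ Hb] Hu; split; [lra|].
  destruct T; simpl in *; try lra; tauto.
Qed.

Lemma inside_open T u : inside T u -> locally u (inside T).
Proof.
  intros [H0 HT]. apply filter_and.
  - apply open_gt; exact H0.
  - destruct T as [t| |]; simpl in *; try tauto.
    + apply open_lt; exact HT.
    + apply filter_forall; tauto.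
Qed.

Lemma left_of_inside T : Rbar_lt 0 T -> left_of T (inside T).
Proof.
  destruct T as [t| |]; simpl; try tauto; intros H.
  - unfold at_left, within, inside.
    eapply filter_imp; [|apply (open_gt 0 t); exact H].
    intros x Hx Hl. simpl. tauto.
  - exists 0. intros x Hx; split; simpl; tauto.
Qed.

(** A point c in the middle separates the neighbourhoods of the two ends. *)
Lemma ends_ordered T : Rbar_lt 0 T ->
  filter_prod (at_right 0) (left_of T)
    (fun ab => inside T (fst ab) /\ inside T (snd ab) /\ fst ab <= snd ab).
Proof.
  intros HT.
  assert (exists c, inside T c /\ left_of T (fun y => c < y)) as (c & Hc & Hl).
  { destruct T as [t| |]; simpl in *; try tauto.
    - exists (t / 2). split; [split; simpl; lra|].
      unfold at_left, within. eapply filter_imp; [|apply (open_gt (t/2) t); lra].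
      tauto.
    - exists 1. split; [split; simpl; try lra; tauto|]. exists 1; tauto. }
  apply Filter_prod with (fun x => inside T x /\ x < c)
    (fun y => inside T y /\ c < y).
  - unfold at_right, within. eapply filter_imp; [|apply (open_lt c 0), Hc].
    intros x Hx H0. split; [|exact Hx]. split; [exact H0|].
    destruct Hc as [_ Hc]; destruct T; simpl in *; try lra; tauto.
  - apply filter_and; [apply left_of_inside, HT| exact Hl].
  - simpl. intros x y [? ?] [? ?]. split; [|split]; [tauto..|lra].
Qed.

Lemma at_right_inside T : Rbar_lt 0 T -> at_right 0 (inside T).
Proof.
  intros HT. unfold at_right, within, inside.
  destruct T as [t| |]; simpl in *; try tauto.
  - eapply filter_imp; [|apply (open_lt t 0); exact HT]. simpl; tauto.
  - apply filter_forall; tauto.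
Qed.

(** ** Complex integrals through their components *)

Lemma is_RInt_C_pair (f : R -> C) a b l :
  is_RInt (V := C_R_NormedModule) f a b l <->
  is_RInt (fun u => Re (f u)) a b (Re l) /\
  is_RInt (fun u => Im (f u)) a b (Im l).
Proof.
  split.
  - intros H; split.
    + apply (is_RInt_fct_extend_fst (U := R_NormedModule) (V := R_NormedModule)
        f a b l H).
    + apply (is_RInt_fct_extend_snd (U := R_NormedModule) (V := R_NormedModule)
        f a b l H).
  - intros [H1 H2]. destruct l as [l1 l2].
    apply (is_RInt_fct_extend_pair (U := R_NormedModule) (V := R_NormedModule)
      f a b l1 l2 H1 H2).
Qed.

Lemma Cint_iff f T l :
  Cint f T l <->
  Rint (fun u => Re (f u)) T (Re l) /\ Rint (fun u => Im (f u)) T (Im l).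
Proof.
  unfold Cint, Rint, is_RInt_gen.
  rewrite !filterlimi_locally. split.
  - intros H; split; intros eps; generalize (H eps); apply filter_imp;
      intros [x y] (z & Hz & Hb); apply is_RInt_C_pair in Hz;
      destruct Hz as [H1 H2], Hb as [B1 B2].
    + exists (Re z); split; [exact H1| exact B1].
    + exists (Im z); split; [exact H2| exact B2].
  - intros [H1 H2] eps. generalize (filter_and _ _ (H1 eps) (H2 eps)).
    apply filter_imp. intros [x y] [(z1 & Hz1 & B1) (z2 & Hz2 & B2)].
    exists (z1, z2); split; [apply is_RInt_C_pair; split; assumption|].
    split; [exact B1| exact B2].
Qed.

Lemma Rint_ext f g T l : Rbar_lt 0 T ->
  (forall u, inside T u -> f u = g u) -> Rint f T l -> Rint g T l.
Proof.
  intros HT H.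
  refine (is_RInt_gen_ext (V := R_NormedModule) f g l _).
  generalize (ends_ordered T HT). apply filter_imp. intros [a b] (Ha & Hb & Hab) u Hu.
  simpl in *. rewrite Rmin_left, Rmax_right in Hu by exact Hab.
  apply H. apply (inside_between T a b); try assumption; lra.
Qed.

Lemma Rint_plus f g T lf lg :
  Rint f T lf -> Rint g T lg -> Rint (fun u => f u + g u) T (lf + lg).
Proof. exact (is_RInt_gen_plus (V := R_NormedModule) f g lf lg). Qed.

Lemma Rint_scal c f T l : Rint f T l -> Rint (fun u => c * f u) T (c * l).
Proof. exact (is_RInt_gen_scal (V := R_NormedModule) f c l). Qed.

Lemma Cint_ext f g T l : Rbar_lt 0 T ->
  (forall u, inside T u -> f u = g u) -> Cint f T l -> Cint g T l.
Proof.
  intros HT H. rewrite !Cint_iff. intros [H1 H2].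
  split; [revert H1|revert H2]; apply Rint_ext; try assumption;
    intros u Hu; rewrite H; trivial.
Qed.

Lemma Cint_plus f g T lf lg :
  Cint f T lf -> Cint g T lg -> Cint (fun u => f u + g u)%C T (lf + lg)%C.
Proof. exact (is_RInt_gen_plus (V := C_R_NormedModule) f g lf lg). Qed.

Lemma Rint_replace f g T l m : Rbar_lt 0 T ->
  (forall u, inside T u -> f u = g u) -> l = m -> Rint f T l -> Rint g T m.
Proof. intros HT H <-. apply Rint_ext; assumption. Qed.

Lemma Cint_replace f g T l m : Rbar_lt 0 T ->
  (forall u, inside T u -> f u = g u) -> l = m -> Cint f T l -> Cint g T m.
Proof. intros HT H <-. apply Cint_ext; assumption. Qed.

Lemma Cint_scal c f T l : Rbar_lt 0 T ->
  Cint f T l -> Cint (fun u => c * f u)%C T (c * l)%C.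
Proof.
  intros HT. rewrite !Cint_iff. intros [H1 H2].
  rewrite re_mult, im_mult. split.
  - eapply Rint_replace; [exact HT| | |
      exact (Rint_plus _ _ _ _ _ (Rint_scal (Re c) _ _ _ H1)
        (Rint_scal (- Im c) _ _ _ H2))]; [|ring].
    intros u _. rewrite re_mult. ring.
  - eapply Rint_replace; [exact HT| | |
      exact (Rint_plus _ _ _ _ _ (Rint_scal (Re c) _ _ _ H2)
        (Rint_scal (Im c) _ _ _ H1))]; [|ring].
    intros u _. rewrite im_mult. ring.
Qed.

Lemma Cint_minus f g T lf lg : Rbar_lt 0 T ->
  Cint f T lf -> Cint g T lg -> Cint (fun u => f u - g u)%C T (lf - lg)%C.
Proof.
  intros HT Hf Hg. eapply Cint_replace; [exact HT| | |
    exact (Cint_plus _ _ _ _ _ Hf (Cint_scal (Copp 1) _ _ _ HT Hg))];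
    intros; cbv beta; ring.
Qed.

Lemma Rint_unique f T l m : Rint f T l -> Rint f T m -> l = m.
Proof.
  intros H1 H2.
  rewrite <- (is_RInt_gen_unique (V := R_CompleteNormedModule) _ _ H1).
  apply (is_RInt_gen_unique (V := R_CompleteNormedModule) _ _ H2).
Qed.

Lemma Cint_unique f T l m : Cint f T l -> Cint f T m -> l = m.
Proof.
  rewrite !Cint_iff. intros [H1 H2] [H3 H4].
  apply C_ext; eapply Rint_unique; eassumption.
Qed.

Lemma Rint_ge_0 f T l : Rbar_lt 0 T ->
  (forall u, inside T u -> 0 <= f u) -> Rint f T l -> 0 <= l.
Proof.
  intros HT H Hf.
  eapply Rle_trans; [apply (norm_ge_0 (V := R_NormedModule) (0 * l))|].
  apply (RInt_gen_norm (V := R_CompleteNormedModule) (Fa := at_right 0)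
    (Fb := left_of T) (fun u => 0 * f u) f); [| |exact (Rint_scal 0 _ _ _ Hf)|exact Hf];
    generalize (ends_ordered T HT); apply filter_imp; intros [a b] (Ha & Hb & Hab).
  - exact Hab.
  - simpl in *. intros u Hu. unfold norm; simpl; unfold abs; simpl.
    rewrite Rmult_0_l, Rabs_R0. apply H, (inside_between T a b); assumption.
Qed.

Lemma Rint_le f g T lf lg : Rbar_lt 0 T ->
  (forall u, inside T u -> f u <= g u) -> Rint f T lf -> Rint g T lg -> lf <= lg.
Proof.
  intros HT H Hf Hg.
  generalize (Rint_ge_0 (fun u => g u + -1 * f u) T (lg + -1 * lf) HT).
  intros Hd. enough (0 <= lg + -1 * lf) by lra. apply Hd.
  - intros u Hu. specialize (H u Hu). lra.
  - apply Rint_plus; [|apply Rint_scal]; assumption.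
Qed.

Lemma Cint_norm_le f g T lf lg : Rbar_lt 0 T ->
  (forall u, inside T u -> Cmod (f u) <= g u) ->
  Cint f T lf -> Rint g T lg -> Cmod lf <= lg.
Proof.
  intros HT H Hf Hg. rewrite <- norm_C_R.
  apply (RInt_gen_norm (V := C_R_CompleteNormedModule) (Fa := at_right 0)
    (Fb := left_of T) f g); [| |exact Hf|exact Hg];
    generalize (ends_ordered T HT); apply filter_imp; intros [a b] (Ha & Hb & Hab).
  - exact Hab.
  - simpl in *. intros u Hu.
    eapply Rle_trans; [right; apply norm_C_R|].
    apply H, (inside_between T a b); assumption.
Qed.

(** Both differences are integrals over the two outer pieces, where d
    dominates f. *)
Lemma RInt_nested_le (f d : R -> R) X x y Y :
  X <= x -> x <= y -> y <= Y -> ex_RInt f X Y -> ex_RInt d X Y ->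
  (forall u, X <= u <= Y -> Rabs (f u) <= d u) ->
  Rabs (RInt f X Y - RInt f x y) <= RInt d X Y - RInt d x y.
Proof.
  intros H1 H2 H3 Hf Hd H.
  assert (E : forall g : R -> R, ex_RInt g X Y ->
    ex_RInt g X x /\ ex_RInt g x y /\ ex_RInt g y Y /\
    (RInt g X Y - RInt g x y = RInt g X x + RInt g y Y)).
  { intros g Hg.
    assert (G1 : ex_RInt g X y) by (apply (ex_RInt_Chasles_1 g X y Y); [lra|exact Hg]).
    assert (G2 : ex_RInt g y Y) by (apply (ex_RInt_Chasles_2 g X y Y); [lra|exact Hg]).
    assert (G3 : ex_RInt g X x) by (apply (ex_RInt_Chasles_1 g X x y); [lra|exact G1]).
    assert (G4 : ex_RInt g x y) by (apply (ex_RInt_Chasles_2 g X x y); [lra|exact G1]).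
    repeat split; try assumption.
    generalize (RInt_Chasles g X y Y G1 G2) (RInt_Chasles g X x y G3 G4).
    unfold plus; simpl. lra. }
  destruct (E f Hf) as (F1 & F2 & F3 & ->), (E d Hd) as (D1 & D2 & D3 & ->).
  eapply Rle_trans; [apply Rabs_triang|]. apply Rplus_le_compat.
  - apply (norm_RInt_le (V := R_NormedModule) f d X x);
      [lra| intros u Hu; apply H; lra| apply (RInt_correct (V:=R_CompleteNormedModule)), F1
      | apply (RInt_correct (V:=R_CompleteNormedModule)), D1].
  - apply (norm_RInt_le (V := R_NormedModule) f d y Y);
      [lra| intros u Hu; apply H; lra| apply (RInt_correct (V:=R_CompleteNormedModule)), F3
      | apply (RInt_correct (V:=R_CompleteNormedModule)), D3].
Qed.

(** Comparison test: by nesting, all integrals over large compact subintervals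
    are within a small distance of each other, so that they form a Cauchy
    filter. *)
Lemma Rint_dominated (f d : R -> R) T D : Rbar_lt 0 T ->
  (forall u, inside T u -> continuous f u) ->
  (forall u, inside T u -> Rabs (f u) <= d u) ->
  Rint d T D -> exists l, Rint f T l.
Proof.
  intros HT Hc H Hd.
  assert (Hex : forall a b, inside T a -> inside T b -> a <= b -> ex_RInt f a b).
  { intros a b Ha Hb Hab. apply (ex_RInt_continuous (V := R_CompleteNormedModule)).
    intros z Hz. rewrite Rmin_left, Rmax_right in Hz by exact Hab.
    apply Hc, (inside_between T a b); assumption. }
  set (F := filter_prod (at_right 0) (left_of T)).
  assert (Hlim : exists l : R,
    filterlim (fun ab => RInt f (fst ab) (snd ab)) F (locally l)).
  { apply (filterlim_locally_cauchy (U := R_CompleteSpace)). intros eps.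
    assert (He : 0 < eps / 4) by (generalize (cond_pos eps); lra).
    unfold Rint, is_RInt_gen in Hd. rewrite filterlimi_locally in Hd.
    generalize (filter_and _ _ (ends_ordered T HT) (Hd (mkposreal _ He))).
    intros [Q1 Q2 HQ1 HQ2 HQ]. simpl in HQ.
    exists (fun ab => Q1 (fst ab) /\ Q2 (snd ab)). split.
    { apply Filter_prod with Q1 Q2; tauto. }
    assert (Hsm : forall x y, Q1 x -> Q2 y -> inside T x /\ inside T y /\ x <= y /\
      ex_RInt d x y /\ Rabs (RInt d x y - D) < eps / 4).
    { intros x y Hx Hy. destruct (HQ x y Hx Hy) as [(Ix & Iy & Hxy) (z & Hz & Hb)].
      repeat split; try apply Ix; try apply Iy; try assumption.
      - exists z; exact Hz.
      - rewrite (is_RInt_unique (V := R_CompleteNormedModule) _ _ _ _ Hz). exact Hb. }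
    (* Two intervals are compared through the smallest one that contains both. *)
    assert (Hcmp : forall X Y x y, Q1 X -> Q2 Y -> Q1 x -> Q2 y -> X <= x -> y <= Y ->
      Rabs (RInt f X Y - RInt f x y) < eps / 2).
    { intros X Y x y HX HY Hx Hy H1 H2.
      destruct (Hsm X Y HX HY) as (IX & IY & HXY & EX & SX).
      destruct (Hsm x y Hx Hy) as (Ix & Iy & Hxy & Ex & Sx).
      eapply Rle_lt_trans; [apply (RInt_nested_le f d X x y Y); try assumption|].
      - apply Hex; assumption.
      - intros u Hu. apply H, (inside_between T X Y); assumption.
      - apply Rabs_def2 in SX. apply Rabs_def2 in Sx. lra. }
    intros [x y] [x' y'] [Hx Hy] [Hx' Hy']. simpl in *.
    assert (HX : Q1 (Rmin x x')) by (unfold Rmin; destruct (Rle_dec x x'); assumption).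
    assert (HY : Q2 (Rmax y y')) by (unfold Rmax; destruct (Rle_dec y y'); assumption).
    generalize (Hcmp _ _ _ _ HX HY Hx Hy (Rmin_l _ _) (Rmax_l _ _)).
    generalize (Hcmp _ _ _ _ HX HY Hx' Hy' (Rmin_r _ _) (Rmax_r _ _)).
    intros A1 A2. apply Rabs_def2 in A1. apply Rabs_def2 in A2.
    apply Rabs_def1; unfold minus, plus, opp; simpl; lra. }
  destruct Hlim as [l Hl]. exists l.
  unfold Rint, is_RInt_gen. apply filterlimi_locally. intros eps.
  apply filterlim_locally with (eps := eps) in Hl.
  generalize (filter_and _ _ (ends_ordered T HT) Hl). apply filter_imp.
  intros [a b] [(Ha & Hb & Hab) Hball]. exists (RInt f a b). split; [|exact Hball].
  apply (RInt_correct (V := R_CompleteNormedModule)), Hex; assumption.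
Qed.

(** * Continuous complex functions and the comparison test *)

Definition Ccont (f : R -> C) (u : R) : Prop :=
  continuous (fun v => Re (f v)) u /\ continuous (fun v => Im (f v)) u.

Lemma Ccont_const c u : Ccont (fun _ => c) u.
Proof. split; apply continuous_const. Qed.

Lemma Ccont_plus f g u : Ccont f u -> Ccont g u -> Ccont (fun v => f v + g v)%C u.
Proof.
  intros [F1 F2] [G1 G2]; split;
    apply (continuous_plus (V := R_NormedModule)); assumption.
Qed.

Lemma Ccont_minus f g u : Ccont f u -> Ccont g u -> Ccont (fun v => f v - g v)%C u.
Proof.
  intros [F1 F2] [G1 G2]; split;
    apply (continuous_minus (V := R_NormedModule)); assumption.
Qed.

Lemma Ccont_mult f g u : Ccont f u -> Ccont g u -> Ccont (fun v => f v * g v)%C u.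
Proof.
  intros [F1 F2] [G1 G2]; split.
  - apply (continuous_minus (V := R_NormedModule));
      apply (continuous_mult (K := R_AbsRing)); assumption.
  - apply (continuous_plus (V := R_NormedModule));
      apply (continuous_mult (K := R_AbsRing)); assumption.
Qed.

Lemma Ccont_pow f u n : Ccont f u -> Ccont (fun v => f v ^ n)%C u.
Proof.
  intros H; induction n as [|n IH]; [apply Ccont_const|].
  exact (Ccont_mult _ _ _ H IH).
Qed.

Lemma Ccont_RtoC (f : R -> R) u : continuous f u -> Ccont (fun v => RtoC (f v)) u.
Proof. intros H; split; [exact H| apply continuous_const]. Qed.

Lemma Cint_dominated (f : R -> C) (d : R -> R) T D : Rbar_lt 0 T ->
  (forall u, inside T u -> Ccont f u) ->
  (forall u, inside T u -> Cmod (f u) <= d u) ->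
  Rint d T D -> exists l, Cint f T l /\ Cmod l <= D.
Proof.
  intros HT Hc H Hd.
  destruct (Rint_dominated (fun u => Re (f u)) d T D HT) as [l1 H1]; try assumption.
  { intros u Hu; exact (proj1 (Hc u Hu)). }
  { intros u Hu; eapply Rle_trans; [apply re_le_Cmod|apply H, Hu]. }
  destruct (Rint_dominated (fun u => Im (f u)) d T D HT) as [l2 H2]; try assumption.
  { intros u Hu; exact (proj2 (Hc u Hu)). }
  { intros u Hu; eapply Rle_trans; [apply Im_le_Cmod|apply H, Hu]. }
  assert (Hl : Cint f T (l1, l2)) by (apply Cint_iff; split; assumption).
  exists (l1, l2). split; [exact Hl|]. apply (Cint_norm_le f d T); assumption.
Qed.
(** * Series of complex functions, integrated term by term *)

Lemma is_series_C_bound (a : nat -> C) (L : C) (e : nat -> R) :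
  (forall n, Cmod (L - sum_n a n)%C <= e n) -> is_lim_seq e 0 ->
  is_series (V := C_NormedModule) a L.
Proof.
  intros H He. apply filterlim_locally. intros eps.
  apply is_lim_seq_spec in He. generalize (He eps). apply filter_imp. intros n Hn.
  rewrite Rminus_0_r in Hn. apply Rabs_def2 in Hn.
  assert (Hc : Cmod (L - sum_n a n)%C < eps) by (eapply Rle_lt_trans; [apply H|lra]).
  split.
  - change (Rabs (Re (sum_n a n) - Re L) < eps). rewrite Rabs_minus_sym, <- Re_minus.
    eapply Rle_lt_trans; [apply re_le_Cmod| exact Hc].
  - change (Rabs (Im (sum_n a n) - Im L) < eps). rewrite Rabs_minus_sym, <- Im_minus.
    eapply Rle_lt_trans; [apply Im_le_Cmod| exact Hc].
Qed.

Lemma is_series_C_close (a : nat -> C) (L : C) (eps : R) : 0 < eps ->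
  is_series (V := C_NormedModule) a L ->
  eventually (fun n => Cmod (L - sum_n a n)%C < eps).
Proof.
  intros He H. assert (He2 : 0 < eps / 2) by lra.
  generalize (proj1 (filterlim_locally _ _) H (mkposreal _ He2)).
  apply filter_imp. intros n [B1 B2].
  change (Rabs (Re (sum_n a n) - Re L) < eps / 2) in B1.
  change (Rabs (Im (sum_n a n) - Im L) < eps / 2) in B2.
  rewrite Rabs_minus_sym, <- Re_minus in B1. rewrite Rabs_minus_sym, <- Im_minus in B2.
  eapply Rle_lt_trans; [apply Cmod_le_Re_Im|]. lra.
Qed.

Lemma CSeries_unique (a : nat -> C) (L : C) :
  is_series (V := C_NormedModule) a L -> CSeries a = L.
Proof.
  intros H. unfold CSeries.
  apply (iota_unique (V := C_CompleteNormedModule)); [|exact H].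
  intros y Hy.
  exact (filterlim_locally_unique (V := C_NormedModule) (sum_n a) y L Hy H).
Qed.

Lemma is_series_C_scal (c : C) (a : nat -> C) (L : C) :
  is_series (V := C_NormedModule) a L ->
  is_series (V := C_NormedModule) (fun n => c * a n)%C (c * L)%C.
Proof. exact (is_series_scal_l (V := C_NormedModule) c a L). Qed.

Definition tail (M : nat -> R) (N : nat) : R := Series M - sum_n M N.

Lemma tail_lim (M : nat -> R) : ex_series M -> is_lim_seq (tail M) 0.
Proof.
  intros HM. unfold tail. replace (Finite 0) with (Finite (Series M - Series M))
    by (f_equal; ring).
  apply is_lim_seq_minus'; [apply is_lim_seq_const| apply (Series_correct M HM)].
Qed.

(** Weierstrass test, with the remainder of the majorant as error bound. *)
Lemma Weierstrass_test (a : nat -> C) (M : nat -> R) :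
  (forall n, Cmod (a n) <= M n) -> ex_series M ->
  is_series (V := C_NormedModule) a (CSeries a) /\
  forall N, Cmod (CSeries a - sum_n a N)%C <= tail M N.
Proof.
  intros H HM.
  assert (Hex : ex_series (V := C_NormedModule) a)
    by exact (ex_series_le (V := C_CompleteNormedModule) a M H HM).
  destruct Hex as [L HL]. rewrite (CSeries_unique a L HL). split; [exact HL|].
  intros N.
  assert (Hpart : forall k, Cmod (sum_n a (N + k) - sum_n a N)%C
      <= sum_n M (N + k) - sum_n M N).
  { induction k as [|k IH].
    - rewrite Nat.add_0_r. unfold Cminus. rewrite Cplus_opp_r, Cmod_0. lra.
    - rewrite Nat.add_succ_r, !sum_Sn. unfold plus; simpl.
      replace (sum_n a (N + k) + a (S (N + k)) - sum_n a N)%C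
        with ((sum_n a (N + k) - sum_n a N) + a (S (N + k)))%C
        by ring.
      eapply Rle_trans; [apply Cmod_triangle|].
      specialize (H (S (N + k))). unfold plus; simpl. lra. }
  assert (Hup : forall k, sum_n M (N + k) <= Series M).
  { intros k. assert (H0 : forall n, 0 <= M n)
      by (intros n; eapply Rle_trans; [apply Cmod_ge_0| apply H]).
    apply (is_lim_seq_incr_compare (sum_n M)); [apply (Series_correct M HM)|].
    intros n. rewrite sum_Sn. unfold plus; simpl. specialize (H0 (S n)). lra. }
  apply le_epsilon. intros eps He.
  destruct (is_series_C_close a L eps He HL) as [K HK].
  specialize (HK (N + K)%nat ltac:(lia)).
  replace (L - sum_n a N)%C with
    ((L - sum_n a (N + K)) + (sum_n a (N + K) - sum_n a N))%C by ring.
  eapply Rle_trans; [apply Cmod_triangle|].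
  specialize (Hpart K). specialize (Hup K). unfold tail. lra.
Qed.

Lemma Weierstrass_bound (a : nat -> C) (M : nat -> R) :
  (forall n, Cmod (a n) <= M n) -> ex_series M -> Cmod (CSeries a) <= Series M.
Proof.
  intros H HM. destruct (Weierstrass_test a M H HM) as [_ HT].
  specialize (HT 0%nat). unfold tail in HT. rewrite !sum_O in HT.
  replace (CSeries a) with ((CSeries a - a 0%nat) + a 0%nat)%C by ring.
  eapply Rle_trans; [apply Cmod_triangle|]. specialize (H 0%nat). lra.
Qed.

(** Continuity survives uniform limits; the projection p stands for the real or
    the imaginary part. *)
Lemma Ccont_uniform_approx (G : R -> C) (u : R) :
  (forall eps, 0 < eps -> exists S : R -> C,
    Ccont S u /\ locally u (fun v => Cmod (G v - S v)%C <= eps)) ->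
  Ccont G u.
Proof.
  intros H.
  assert (E : forall p : C -> R, (forall z w, p (z - w)%C = p z - p w) ->
    (forall z, Rabs (p z) <= Cmod z) ->
    (forall S, Ccont S u -> continuous (fun v => p (S v)) u) ->
    continuous (fun v => p (G v)) u).
  { intros p Hp Hle Hc. apply filterlim_locally. intros eps.
    assert (He : 0 < eps / 3) by (generalize (cond_pos eps); lra).
    destruct (H _ He) as (S & HS & Hl).
    generalize (Hc S HS). intros HcS.
    generalize (locally_singleton _ _ Hl) (filter_and _ _ Hl
      (proj1 (filterlim_locally _ _) HcS (mkposreal _ He))). intros H0.
    apply filter_imp. intros v [Hv Hb].
    change (Rabs (p (S v) - p (S u)) < eps / 3) in Hb.
    change (Rabs (p (G v) - p (G u)) < eps).
    apply Rabs_def2 in Hb.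
    generalize (Rle_trans _ _ _ (Hle _) Hv) (Rle_trans _ _ _ (Hle _) H0).
    rewrite !Hp. intros A1 A2.
    apply Rabs_le_between in A1. apply Rabs_le_between in A2.
    apply Rabs_def1; lra. }
  split; apply E; try reflexivity; try (intros S HS; apply HS).
  - apply re_le_Cmod.
  - apply Im_le_Cmod.
Qed.

Lemma Ccont_sum_n (g : nat -> R -> C) u N :
  (forall n, Ccont (g n) u) -> Ccont (fun v => sum_n (fun n => g n v) N) u.
Proof.
  intros H. induction N as [|N IH].
  - destruct (H 0%nat) as [H1 H2]. split.
    + eapply continuous_ext; [|exact H1]. intros v; cbv beta. rewrite sum_O; reflexivity.
    + eapply continuous_ext; [|exact H2]. intros v; cbv beta. rewrite sum_O; reflexivity.
  - destruct (Ccont_plus _ _ u IH (H (S N))) as [H1 H2]. split.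
    + eapply continuous_ext; [|exact H1]. intros v; cbv beta. rewrite sum_Sn; reflexivity.
    + eapply continuous_ext; [|exact H2]. intros v; cbv beta. rewrite sum_Sn; reflexivity.
Qed.

Lemma Ccont_CSeries (g : nat -> R -> C) (M : nat -> R) T u :
  (forall n v, inside T v -> Ccont (g n) v) ->
  (forall n v, inside T v -> Cmod (g n v) <= M n) -> ex_series M ->
  inside T u -> Ccont (fun v => CSeries (fun n => g n v)) u.
Proof.
  intros Hc Hb HM Hu. apply Ccont_uniform_approx. intros eps He.
  generalize (tail_lim M HM). intros Ht. apply is_lim_seq_spec in Ht.
  destruct (Ht (mkposreal _ He)) as [N HN]. specialize (HN N (Nat.le_refl _)).
  simpl in HN. rewrite Rminus_0_r in HN. apply Rabs_def2 in HN.
  exists (fun v => sum_n (fun n => g n v) N). split.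
  - apply Ccont_sum_n. intros n; apply Hc, Hu.
  - generalize (inside_open T u Hu). apply filter_imp. intros v Hv.
    destruct (Weierstrass_test (fun n => g n v) M) as [_ Hr];
      [intros n; apply Hb, Hv| exact HM|].
    eapply Rle_trans; [apply Hr|]. lra.
Qed.

(** The part of the series beyond the index N contributes to the integral at
    most the remainder of the majorant M times the integral of d, hence the
    partial sums of the integrals converge to the integral of the sum. *)
Lemma Cint_series (w : R -> C) (g : nat -> R -> C) (d : R -> R) (M : nat -> R)
    T D (I : nat -> C) : Rbar_lt 0 T ->
  (forall u, inside T u -> Ccont w u) ->
  (forall u, inside T u -> Cmod (w u) <= d u) -> Rint d T D ->
  (forall n u, inside T u -> Ccont (g n) u) ->
  (forall n u, inside T u -> Cmod (g n u) <= M n) -> ex_series M ->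
  (forall n, Cint (fun u => w u * g n u)%C T (I n)) ->
  exists L : C, is_series (V := C_NormedModule) I L /\
    Cint (fun u => w u * CSeries (fun n => g n u))%C T L.
Proof.
  intros HT Hwc Hwd Hd Hgc HgM HM HI.
  destruct (Cint_dominated (fun u => w u * CSeries (fun n => g n u))%C
    (fun u => Series M * d u) T (Series M * D) HT) as (L & HL & _).
  { intros u Hu. apply Ccont_mult; [apply Hwc, Hu|].
    apply (Ccont_CSeries g M T u); assumption. }
  { intros u Hu. rewrite Cmod_mult, (Rmult_comm (Series M)).
    apply Rmult_le_compat; [apply Cmod_ge_0..| apply Hwd, Hu|].
    apply Weierstrass_bound; [intros n; apply HgM, Hu| exact HM]. }
  { apply Rint_scal, Hd. }
  exists L. split; [|exact HL].
  apply (is_series_C_bound I L (fun N => tail M N * D)).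
  - intros N.
    assert (HS : Cint (fun u => w u * sum_n (fun n => g n u) N)%C T (sum_n I N)).
    { induction N as [|N IH].
      - eapply Cint_replace; [exact HT| | |apply (HI 0%nat)];
          [intros u _; cbv beta|]; rewrite sum_O; reflexivity.
      - eapply Cint_replace; [exact HT| | |apply (Cint_plus _ _ _ _ _ IH (HI (S N)))].
        + intros u _. cbv beta. rewrite sum_Sn. unfold plus; simpl. ring.
        + rewrite sum_Sn. reflexivity. }
    apply (Cint_norm_le (fun u => w u * CSeries (fun n => g n u)
        - w u * sum_n (fun n => g n u) N)%C (fun u => tail M N * d u) T); try assumption.
    + intros u Hu.
      replace (w u * CSeries (fun n => g n u) - w u * sum_n (fun n => g n u) N)%C
        with ((CSeries (fun n => g n u) - sum_n (fun n => g n u) N) * w u)%C by ring.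
      rewrite Cmod_mult. apply Rmult_le_compat; [apply Cmod_ge_0..| |apply Hwd, Hu].
      apply Weierstrass_test; [intros n; apply HgM, Hu| exact HM].
    + apply Cint_minus; assumption.
    + apply Rint_scal, Hd.
  - replace (Finite 0) with (Rbar_mult 0 D) by (simpl; f_equal; ring).
    apply is_lim_seq_scal_r, tail_lim, HM.
Qed.
(** * Complex powers of positive reals *)

Lemma Rpowc_plus u z w : Rpowc u (z + w) = (Rpowc u z * Rpowc u w)%C.
Proof.
  unfold Rpowc. rewrite Re_plus, Im_plus, !Rmult_plus_distr_r, exp_plus, cos_plus,
    sin_plus.
  apply C_ext; simpl; ring.
Qed.

Lemma Rpowc_mult_base u v z : 0 < u -> 0 < v ->
  Rpowc (u * v) z = (Rpowc u z * Rpowc v z)%C.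
Proof.
  intros Hu Hv. unfold Rpowc. rewrite ln_mult by assumption.
  rewrite !Rmult_plus_distr_l, exp_plus, cos_plus, sin_plus.
  apply C_ext; simpl; ring.
Qed.

Lemma Cmod_Rpowc u z : Cmod (Rpowc u z) = Rpower u (Re z).
Proof.
  unfold Cmod, Rpowc, Rpower; simpl. set (e := exp _). set (th := Im z * ln u).
  replace (e * cos th * (e * cos th * 1) + e * sin th * (e * sin th * 1))
    with (Rsqr e * (Rsqr (sin th) + Rsqr (cos th))) by (unfold Rsqr; ring).
  rewrite sin2_cos2, Rmult_1_r, sqrt_Rsqr; [reflexivity| left; apply exp_pos].
Qed.

Lemma Rpower_pos u r : 0 < Rpower u r.
Proof. apply exp_pos. Qed.

Lemma Rpowc_neq_0 u z : Rpowc u z <> 0.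
Proof. apply Cmod_gt_0. rewrite Cmod_Rpowc. apply Rpower_pos. Qed.

Lemma Rpowc_RtoC u r : Rpowc u (RtoC r) = RtoC (Rpower u r).
Proof.
  unfold Rpowc, Rpower. apply C_ext; simpl; rewrite Rmult_0_l, ?cos_0, ?sin_0; ring.
Qed.

Lemma Rpowc_0 u : Rpowc u 0 = 1.
Proof.
  rewrite Rpowc_RtoC. unfold Rpower. rewrite Rmult_0_l, exp_0. reflexivity.
Qed.

Lemma Rpowc_INR u k : 0 < u -> Rpowc u (INR k) = (RtoC u ^ k)%C.
Proof.
  intros Hu. rewrite Rpowc_RtoC, Rpower_pow by assumption. apply RtoC_pow.
Qed.

Lemma Rpowc_1 u : 0 < u -> Rpowc u 1 = u.
Proof. intros Hu. rewrite Rpowc_RtoC, Rpower_1 by exact Hu. reflexivity. Qed.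

Lemma Rpowc_base_1 z : Rpowc 1 z = 1.
Proof.
  unfold Rpowc. rewrite ln_1, !Rmult_0_r, exp_0, cos_0, sin_0. 
  apply C_ext; simpl; ring.
Qed.

Lemma Rpowc_minus_1 u z : 0 < u -> Rpowc u z = (u * Rpowc u (z - 1))%C.
Proof.
  intros Hu. transitivity (Rpowc u 1 * Rpowc u (z - 1))%C.
  - rewrite <- Rpowc_plus. f_equal. ring.
  - rewrite (Rpowc_1 u Hu). reflexivity.
Qed.

(** * Derivatives and the fundamental theorem of calculus *)

Definition Cder (f : R -> C) (u : R) (l : C) : Prop :=
  is_derive (fun v => Re (f v)) u (Re l) /\ is_derive (fun v => Im (f v)) u (Im l).

Lemma Cder_Ccont f u l : Cder f u l -> Ccont f u.
Proof.
  intros [H1 H2]; split; apply (ex_derive_continuous (V := R_NormedModule));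
    eexists; eassumption.
Qed.

Lemma Cder_mult f g u df dg : Cder f u df -> Cder g u dg ->
  Cder (fun v => f v * g v)%C u (df * g u + f u * dg)%C.
Proof.
  intros [F1 F2] [G1 G2].
  assert (E : forall a b da db, is_derive a u da -> is_derive b u db ->
    is_derive (fun v => a v * b v) u (da * b u + a u * db)).
  { intros a b da db Ha Hb. apply (is_derive_mult (K := R_AbsRing) a b u da db Ha Hb).
    intros; apply Rmult_comm. }
  split.
  - evar_last; [apply (is_derive_minus (V := R_NormedModule)); apply E;
      [exact F1|exact G1|exact F2|exact G2]|].
    unfold minus, plus, opp; simpl. unfold Re, Im. simpl. ring.
  - evar_last; [apply (is_derive_plus (V := R_NormedModule)); apply E;
      [exact F1|exact G2|exact F2|exact G1]|].
    unfold minus, plus, opp; simpl. unfold Re, Im. simpl. ring.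
Qed.

Lemma Cder_RtoC (f : R -> R) u l : is_derive f u l -> Cder (fun v => RtoC (f v)) u l.
Proof. intros H; split; [exact H| exact (is_derive_const (V := R_NormedModule) 0 u)]. Qed.

Lemma Rpower_minus_1 u r : 0 < u -> Rpower u (r - 1) = Rpower u r / u.
Proof.
  intros Hu. unfold Rminus. rewrite Rpower_plus, Rpower_Ropp, Rpower_1 by exact Hu.
  reflexivity.
Qed.

Lemma Cder_Rpowc z u : 0 < u -> Cder (fun v => Rpowc v z) u (z * Rpowc u (z - 1))%C.
Proof.
  intros Hu.
  assert (E : exp ((Re z - 1) * ln u) = exp (Re z * ln u) / u)
    by exact (Rpower_minus_1 u (Re z) Hu).
  unfold Cder, Rpowc. rewrite Re_minus, Im_minus. simpl (Re 1). simpl (Im 1).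
  rewrite E, Rminus_0_r, re_mult, im_mult. simpl. split.
  - auto_derive; [tauto|]. field. lra.
  - auto_derive; [tauto|]. field. lra.
Qed.

Lemma Cder_Rpowc_sub t z u : u < t ->
  Cder (fun v => Rpowc (t - v) z) u (- (z * Rpowc (t - u) (z - 1)))%C.
Proof.
  intros Hu. destruct (Cder_Rpowc z (t - u) ltac:(lra)) as [H1 H2].
  assert (E : is_derive (fun v => t - v) u (-1)) by (auto_derive; [trivial|ring]).
  split.
  - evar_last; [exact (is_derive_comp (V := R_NormedModule) _ _ u _ _ H1 E)|].
    unfold scal; simpl; unfold mult; simpl. unfold Re; simpl. ring.
  - evar_last; [exact (is_derive_comp (V := R_NormedModule) _ _ u _ _ H2 E)|].
    unfold scal; simpl; unfold mult; simpl. unfold Im; simpl. ring.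
Qed.

Lemma Ccont_Rpowc z u : 0 < u -> Ccont (fun v => Rpowc v z) u.
Proof. intros Hu. eapply Cder_Ccont, Cder_Rpowc, Hu. Qed.

Lemma Ccont_Rpowc_sub t z u : u < t -> Ccont (fun v => Rpowc (t - v) z) u.
Proof. intros Hu. eapply Cder_Ccont, Cder_Rpowc_sub, Hu. Qed.

Lemma Rint_FTC (F f : R -> R) T la lb : Rbar_lt 0 T ->
  (forall u, inside T u -> is_derive F u (f u)) ->
  (forall u, inside T u -> continuous f u) ->
  filterlim F (at_right 0) (locally la) -> filterlim F (left_of T) (locally lb) ->
  Rint f T (lb - la).
Proof.
  intros HT HF Hf Ha Hb. unfold Rint, is_RInt_gen.
  apply filterlimi_locally. intros eps.
  assert (He : 0 < eps / 2) by (generalize (cond_pos eps); lra).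
  generalize (proj1 (filterlim_locally _ _) Ha (mkposreal _ He))
    (proj1 (filterlim_locally _ _) Hb (mkposreal _ He)). intros La Lb.
  assert (Lab : filter_prod (at_right 0) (left_of T) (fun ab =>
    ball la (eps / 2) (F (fst ab)) /\ ball lb (eps / 2) (F (snd ab)))).
  { eapply Filter_prod; [exact La| exact Lb|]. intros x y Hx Hy. split; assumption. }
  generalize (filter_and _ _ (ends_ordered T HT) Lab). apply filter_imp.
  intros [a b] [(Ia & Ib & Hab) [Ba Bb]]. simpl in *.
  exists (F b - F a). split.
  - apply (is_RInt_derive (V := R_CompleteNormedModule) F f);
      intros x Hx; rewrite Rmin_left, Rmax_right in Hx by exact Hab;
      [apply HF| apply Hf]; apply (inside_between T a b); assumption.
  - change (Rabs (F a - la) < eps / 2) in Ba. change (Rabs (F b - lb) < eps / 2) in Bb.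
    change (Rabs (F b - F a - (lb - la)) < eps).
    apply Rabs_def2 in Ba. apply Rabs_def2 in Bb. apply Rabs_def1; lra.
Qed.

Definition Clim (F : R -> C) (flt : (R -> Prop) -> Prop) (l : C) : Prop :=
  filterlim (fun u => Re (F u)) flt (locally (Re l)) /\
  filterlim (fun u => Im (F u)) flt (locally (Im l)).

Lemma Clim_0 (F : R -> C) (g : R -> R) flt {HF : Filter flt} :
  flt (fun u => Cmod (F u) <= g u) -> filterlim g flt (locally 0) -> Clim F flt 0.
Proof.
  intros H Hg.
  assert (E : forall p : C -> R, (forall z, Rabs (p z) <= Cmod z) ->
    filterlim (fun u => p (F u)) flt (locally 0)).
  { intros p Hp. apply filterlim_locally. intros eps.
    generalize (filter_and _ _ H (proj1 (filterlim_locally _ _) Hg eps)).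
    apply filter_imp. intros u [H1 H2].
    change (Rabs (g u - 0) < eps) in H2. change (Rabs (p (F u) - 0) < eps).
    rewrite Rminus_0_r in *. apply Rabs_def2 in H2. specialize (Hp (F u)). lra. }
  split; [apply (E Re), re_le_Cmod| apply (E Im), Im_le_Cmod].
Qed.

Lemma Cint_FTC (F f : R -> C) T la lb : Rbar_lt 0 T ->
  (forall u, inside T u -> Cder F u (f u)) ->
  (forall u, inside T u -> Ccont f u) ->
  Clim F (at_right 0) la -> Clim F (left_of T) lb -> Cint f T (lb - la)%C.
Proof.
  intros HT HF Hf [A1 A2] [B1 B2]. apply Cint_iff. split.
  - apply (Rint_FTC (fun u => Re (F u))); try assumption; intros u Hu.
    + exact (proj1 (HF u Hu)).
    + exact (proj1 (Hf u Hu)).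
  - apply (Rint_FTC (fun u => Im (F u))); try assumption; intros u Hu.
    + exact (proj2 (HF u Hu)).
    + exact (proj2 (Hf u Hu)).
Qed.

(** * Convergence of the Gamma integral *)

Lemma filterlim_le_0 (f g : R -> R) flt {HF : Filter flt} :
  flt (fun u => 0 <= f u <= g u) -> filterlim g flt (locally 0) ->
  filterlim f flt (locally 0).
Proof.
  intros H Hg. apply filterlim_locally. intros eps.
  generalize (filter_and _ _ H (proj1 (filterlim_locally _ _) Hg eps)).
  apply filter_imp. intros u [H1 H2].
  change (Rabs (g u - 0) < eps) in H2. change (Rabs (f u - 0) < eps).
  rewrite Rminus_0_r in *. apply Rabs_def2 in H2. apply Rabs_def1; lra.
Qed.

Lemma Rpower_lim_0 c : 0 < c -> filterlim (fun u => Rpower u c) (at_right 0) (locally 0).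
Proof.
  intros Hc. apply filterlim_locally. intros eps.
  assert (Hd : 0 < Rpower eps (/ c)) by apply Rpower_pos.
  exists (mkposreal _ Hd). intros u Hu H0.
  change (Rabs (u - 0) < Rpower eps (/ c)) in Hu. rewrite Rminus_0_r in Hu.
  apply Rabs_def2 in Hu. change (Rabs (Rpower u c - 0) < eps).
  rewrite Rminus_0_r, Rabs_pos_eq by (left; apply Rpower_pos).
  replace (pos eps) with (Rpower (Rpower eps (/ c)) c).
  - apply Rlt_Rpower_l; [exact Hc| lra].
  - rewrite Rpower_mult, Rinv_l, Rpower_1; [reflexivity| apply cond_pos| lra].
Qed.

Lemma Rpower_sub_lim_0 c t : 0 < c ->
  filterlim (fun u => Rpower (t - u) c) (at_left t) (locally 0).
Proof.
  intros Hc. apply (filterlim_comp _ _ _ (fun u => t - u) (fun v => Rpower v c)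
    _ (at_right 0)); [|apply Rpower_lim_0, Hc].
  intros P [eps HP]. exists eps. intros u Hu Hl. apply HP; [|lra].
  change (Rabs (u - t) < eps) in Hu. change (Rabs (t - u - 0) < eps).
  rewrite Rminus_0_r, Rabs_minus_sym. exact Hu.
Qed.

Lemma exp_incr_le x y : x <= y -> exp x <= exp y.
Proof. intros [H| ->]; [left; apply exp_increasing, H| right; reflexivity]. Qed.

(** The function u^c e^(-u) is largest at u = c; the proof is ln x <= x - 1 at
    x = u/c. *)
Lemma Rpower_le_exp c u : 0 < c -> 0 < u -> Rpower u c <= Rpower c c * exp (u - c).
Proof.
  intros Hc Hu. unfold Rpower. rewrite <- exp_plus. apply exp_incr_le.
  assert (H : ln (u / c) <= u / c - 1).
  { assert (0 < u / c) by (apply Rdiv_lt_0_compat; lra).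
    generalize (exp_ineq1_le (ln (u / c))). rewrite exp_ln by assumption. lra. }
  rewrite ln_div in H by lra.
  apply (Rmult_le_compat_l c) in H; [|lra].
  replace (c * (u / c - 1)) with (u - c) in H by (field; lra). lra.
Qed.

(** The integrand has the elementary primitive (u/(1+u))^c.  It behaves like
    the Gamma integrand at 0 and decays more slowly at infinity, which makes it
    a majorant up to a constant. *)
Lemma Rint_power_decay c : 0 < c ->
  Rint (fun u => c * (Rpower u (c - 1) * Rpower (1 + u) (- (c + 1)))) p_infty 1.
Proof.
  intros Hc.
  match goal with |- Rint ?f _ _ =>
    enough (H : Rint f p_infty (1 - 0)) by (rewrite Rminus_0_r in H; exact H) end.
  apply (Rint_FTC (fun u => Rpower (u / (1 + u)) c)); simpl; [trivial|..].
  - intros u [Hu _]. unfold Rpower at 1. auto_derive.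
    + repeat split; try lra. apply Rdiv_lt_0_compat; lra.
    + change (exp (c * ln (u * / (1 + u)))) with (Rpower (u / (1 + u)) c).
      rewrite (Rpower_minus_1 u c), Rpower_Ropp, Rpower_plus, Rpower_1 by lra.
      unfold Rpower. unfold Rdiv at 1. rewrite ln_mult, ln_Rinv by
        (try apply Rinv_0_lt_compat; lra).
      replace (c * (ln u + - ln (1 + u))) with (c * ln u + - (c * ln (1 + u))) by ring.
      rewrite exp_plus, exp_Ropp. field. repeat split; try lra.
      apply Rgt_not_eq, exp_pos.
  - intros u [Hu _]. apply (ex_derive_continuous (V := R_NormedModule)).
    unfold Rpower. auto_derive. repeat split; lra.
  - apply (filterlim_le_0 _ (fun u => Rpower u c) (at_right 0)); [|apply Rpower_lim_0, Hc].
    unfold at_right, within. apply filter_forall. intros u Hu.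
    split; [left; apply Rpower_pos|].
    apply Rle_Rpower_l; [lra|]. split; [apply Rdiv_lt_0_compat; lra|].
    apply Rle_div_l; [lra|]. nra.
  - apply filterlim_locally. intros eps. exists (c / eps). intros u Hu.
    assert (H0 : 0 < c / eps) by (apply Rdiv_lt_0_compat; [lra| apply cond_pos]).
    change (Rabs (Rpower (u / (1 + u)) c - 1) < eps).
    assert (Hp : 0 < u / (1 + u)) by (apply Rdiv_lt_0_compat; lra).
    (* The distance to the limit 1 is at most c/u. *)
    assert (Hl : - / u <= ln (u / (1 + u))).
    { generalize (exp_ineq1_le (ln ((1 + u) / u))).
      rewrite exp_ln by (apply Rdiv_lt_0_compat; lra).
      rewrite !ln_div by lra.
      replace ((1 + u) / u) with (/ u + 1) by (field; lra). lra. }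
    assert (Hl2 : ln (u / (1 + u)) <= 0).
    { rewrite <- ln_1. apply ln_le; [exact Hp|]. apply Rle_div_l; lra. }
    assert (Hcu : c / u < eps).
    { apply Rlt_div_l; [lra|]. apply Rlt_div_l in Hu; [lra| apply cond_pos]. }
    unfold Rpower. generalize (exp_ineq1_le (c * ln (u / (1 + u)))).
    assert (exp (c * ln (u / (1 + u))) <= exp 0) by (apply exp_incr_le; nra).
    rewrite exp_0 in *. intros Hx.
    assert (- (c / u) <= c * ln (u / (1 + u)))
      by (unfold Rdiv at 1; rewrite Ropp_mult_distr_r; apply Rmult_le_compat_l; lra).
    apply Rabs_def1; lra.
Qed.

Definition Gamma_integrand (z : C) (u : R) : C := (Rpowc u (z - 1) * exp (- u))%C.

Lemma Gamma_integrand_cont z u : 0 < u -> Ccont (Gamma_integrand z) u.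
Proof.
  intros Hu. apply Ccont_mult; [apply Ccont_Rpowc, Hu|]. apply Ccont_RtoC.
  apply (ex_derive_continuous (V := R_NormedModule)). auto_derive. trivial.
Qed.

Lemma Cmod_Gamma_integrand z u :
  Cmod (Gamma_integrand z u) = Rpower u (Re z - 1) * exp (- u).
Proof.
  unfold Gamma_integrand. rewrite Cmod_mult, Cmod_Rpowc, Cmod_R, Re_minus.
  rewrite (Rabs_pos_eq (exp _)) by (left; apply exp_pos). reflexivity.
Qed.

Lemma Cint_Gamma z : 0 < Re z -> Cint (Gamma_integrand z) p_infty (Gamma z).
Proof.
  intros Hz. set (c := Re z) in *.
  destruct (Cint_dominated (Gamma_integrand z)
    (fun u => (Rpower (c + 1) (c + 1) * exp (- c) / c) *
      (c * (Rpower u (c - 1) * Rpower (1 + u) (- (c + 1)))))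
    p_infty (Rpower (c + 1) (c + 1) * exp (- c) / c * 1) I (fun u Hu => Gamma_integrand_cont z u (proj1 Hu))) as (l & Hl & _).
  - intros u [Hu _]. rewrite Cmod_Gamma_integrand. fold c.
    generalize (Rpower_le_exp (c + 1) (1 + u) ltac:(lra) ltac:(lra)).
    replace (1 + u - (c + 1)) with (u + - c) by ring. rewrite exp_plus. intros H.
    rewrite Rpower_Ropp.
    assert (H1 := Rpower_pos (1 + u) (c + 1)).
    replace (Rpower (c + 1) (c + 1) * exp (- c) / c *
      (c * (Rpower u (c - 1) * / Rpower (1 + u) (c + 1))))
      with (Rpower u (c - 1) * (Rpower (c + 1) (c + 1) * exp (- c)
        / Rpower (1 + u) (c + 1))) by (field; split; lra).
    apply Rmult_le_compat_l; [left; apply Rpower_pos|].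
    apply Rle_div_r; [exact H1|].
    apply (Rmult_le_compat_l (exp (- u))) in H; [|left; apply exp_pos].
    replace (exp (- u) * (Rpower (c + 1) (c + 1) * (exp u * exp (- c))))
      with (exp (- u) * exp u * (Rpower (c + 1) (c + 1) * exp (- c))) in H by ring.
    rewrite <- exp_plus, Rplus_opp_l, exp_0 in H. lra.
  - apply Rint_scal, Rint_power_decay, Hz.
  - exact (RInt_gen_correct (V := C_R_CompleteNormedModule)
      (Fa := at_right 0) (Fb := Rbar_locally p_infty) (Gamma_integrand z)
      (ex_intro _ l Hl)).
Qed.
(** * Functional equation and size of the Gamma function *)

Lemma exp_decay_lim (s : R) : 0 < s ->
  filterlim (fun u => Rpower u s * exp (- u)) (Rbar_locally p_infty) (locally 0).
Proof.
  intros Hs. set (K := Rpower (s + 1) (s + 1) * exp (- (s + 1))).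
  apply (filterlim_le_0 _ (fun u => K * / u) (Rbar_locally p_infty)).
  - exists 0. intros u Hu.
    assert (Hp := Rpower_pos u s). assert (He := exp_pos (- u)).
    split; [apply Rmult_le_pos; lra|].
    generalize (Rpower_le_exp (s + 1) u ltac:(lra) Hu).
    rewrite Rpower_plus, Rpower_1 by exact Hu.
    unfold Rminus. rewrite exp_plus. intros H.
    apply (Rmult_le_compat_r (exp (- u) * / u)) in H;
      [|apply Rmult_le_pos; [lra| left; apply Rinv_0_lt_compat, Hu]].
    replace (Rpower u s * u * (exp (- u) * / u)) with (Rpower u s * exp (- u)) in H
      by (field; lra).
    eapply Rle_trans; [exact H|]. right. unfold K. rewrite !exp_Ropp.
    field. repeat split; try lra; apply Rgt_not_eq, exp_pos.
  - replace 0 with (K * 0) by ring.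
    apply (filterlim_comp _ _ _ (fun u => / u) (fun v => K * v) _ (locally 0)).
    + exact (filterlim_Rbar_inv p_infty ltac:(discriminate)).
    + apply (filterlim_scal_r (K := R_AbsRing) (V := R_NormedModule) K 0).
Qed.

(** The integral of the derivative of u^z e^(-u), which vanishes at both ends,
    is zero. *)
Lemma Gamma_S z : 0 < Re z -> Gamma (z + 1) = (z * Gamma z)%C.
Proof.
  intros Hz.
  assert (Hz1 : 0 < Re (z + 1)) by (rewrite Re_plus; simpl; lra).
  assert (H1 : Cint (fun u => z * Gamma_integrand z u - Gamma_integrand (z + 1) u)%C
    p_infty (z * Gamma z - Gamma (z + 1))%C).
  { apply Cint_minus; [exact I| apply Cint_scal; [exact I|]|]; apply Cint_Gamma;
      assumption. }
  assert (H2 : Cint (fun u => z * Gamma_integrand z u - Gamma_integrand (z + 1) u)%C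
    p_infty (0 - 0)%C).
  { assert (Hmod : forall u, Cmod (Rpowc u z * exp (- u))%C = Rpower u (Re z) * exp (- u)).
    { intros u. rewrite Cmod_mult, Cmod_Rpowc, Cmod_R, (Rabs_pos_eq (exp _));
        [reflexivity| left; apply exp_pos]. }
    apply (Cint_FTC (fun u => Rpowc u z * exp (- u))%C).
    - exact I.
    - intros u [Hu _].
      assert (He : is_derive (fun v => exp (- v)) u (- exp (- u)))
        by (auto_derive; [trivial| ring]).
      generalize (Cder_mult _ _ u _ _ (Cder_Rpowc z u Hu) (Cder_RtoC _ u _ He)).
      unfold Gamma_integrand. replace (z + 1 - 1)%C with z by ring.
      intros H. evar (l : C). replace (_ - _)%C with l; [exact H|].
      unfold l. rewrite RtoC_opp. ring.
    - intros u [Hu _]. apply Ccont_minus;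
        [apply Ccont_mult; [apply Ccont_const|]|]; apply Gamma_integrand_cont, Hu.
    - apply (Clim_0 _ (fun u => Rpower u (Re z)) (at_right 0)); [|apply Rpower_lim_0, Hz].
      unfold at_right, within. apply filter_forall. intros u Hu. rewrite Hmod.
      assert (Hp := Rpower_pos u (Re z)).
      assert (exp (- u) <= 1) by (rewrite <- exp_0; apply exp_incr_le; lra). nra.
    - apply (Clim_0 _ (fun u => Rpower u (Re z) * exp (- u)) (Rbar_locally p_infty));
        [|apply exp_decay_lim, Hz].
      exists 0. intros u Hu. rewrite Hmod. lra. }
  generalize (Cint_unique _ _ _ _ H1 H2). intros H.
  replace (Gamma (z + 1)) with (z * Gamma z - (z * Gamma z - Gamma (z + 1)))%C by ring.
  rewrite H. ring.
Qed.

Definition GammaR (c : R) : R := Re (Gamma c).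

Lemma Rint_GammaR c : 0 < c ->
  Rint (fun u => Rpower u (c - 1) * exp (- u)) p_infty (GammaR c).
Proof.
  intros Hc. destruct (proj1 (Cint_iff _ _ _) (Cint_Gamma c Hc)) as [H _].
  eapply Rint_ext; [exact I| |exact H].
  intros u _. cbv beta. unfold Gamma_integrand. rewrite <- RtoC_minus, Rpowc_RtoC.
  simpl. ring.
Qed.

Lemma GammaR_S c : 0 < c -> GammaR (c + 1) = c * GammaR c.
Proof.
  intros Hc. unfold GammaR. rewrite RtoC_plus, Gamma_S by exact Hc. simpl. ring.
Qed.

Lemma GammaR_1 : GammaR 1 = 1.
Proof.
  eapply Rint_unique; [apply Rint_GammaR; lra|].
  enough (H : Rint (fun u => Rpower u (1 - 1) * exp (- u)) p_infty (- 0 - - exp (- 0)))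
    by (rewrite !Ropp_0, exp_0 in H; replace (0 - - (1)) with 1 in H by ring; exact H).
  apply (Rint_FTC (fun u => - exp (- u))).
  - exact I.
  - intros u [Hu _]. auto_derive; [trivial|].
    rewrite Rminus_diag, Rpower_O by exact Hu. ring.
  - intros u [Hu _]. apply (ex_derive_continuous (V := R_NormedModule)).
    unfold Rpower. auto_derive. lra.
  - intros P HP. apply filter_le_within. revert P HP.
    apply (ex_derive_continuous (V := R_NormedModule) (fun u => - exp (- u)) 0).
    auto_derive. trivial.
  - apply (filterlim_comp _ _ _ (fun u => exp (- u)) Ropp _ (locally 0));
      [|apply (filterlim_opp (V := R_NormedModule))].
    apply (filterlim_le_0 _ (fun u => Rpower u 1 * exp (- u)) (Rbar_locally p_infty));
      [|apply exp_decay_lim; lra].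
    exists 1. intros u Hu. rewrite Rpower_1 by lra.
    assert (He := exp_pos (- u)). nra.
Qed.

Lemma GammaR_nat_ge_1 m : 1 <= GammaR (INR m + 1).
Proof.
  induction m as [|m IH].
  - simpl. rewrite Rplus_0_l, GammaR_1. lra.
  - assert (H := pos_INR m). rewrite S_INR, GammaR_S by lra. nra.
Qed.

(** The power u^(c-1) dominates m^(c-m-2) (u - m) u^m: for u < m the latter is
    negative, for u >= m it is at most m^(c-m-2) u^(m+1).  Integrated against
    e^(-u), the factor (u - m) u^m gives (m+1)! - m m! = m! >= 1. *)
Lemma GammaR_growth (m : nat) c : (1 <= m)%nat -> INR m + 2 <= c ->
  Rpower (INR m) (c - (INR m + 2)) <= GammaR c.
Proof.
  intros Hm Hc. apply le_INR in Hm. simpl in Hm. set (M := INR m) in *.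
  assert (HG : GammaR (M + 2) - M * GammaR (M + 1) = GammaR (M + 1)).
  { replace (M + 2) with ((M + 1) + 1) by ring. rewrite GammaR_S by lra. ring. }
  apply Rle_trans with (Rpower M (c - (M + 2)) * (GammaR (M + 2) + - M * GammaR (M + 1))).
  - replace (GammaR (M + 2) + - M * GammaR (M + 1)) with (GammaR (M + 1)) by lra.
    generalize (GammaR_nat_ge_1 m) (Rpower_pos M (c - (M + 2))). fold M. nra.
  - apply (Rint_le (fun u => Rpower M (c - (M + 2)) *
      (Rpower u (M + 2 - 1) * exp (- u) + - M * (Rpower u (M + 1 - 1) * exp (- u))))
      (fun u => Rpower u (c - 1) * exp (- u)) p_infty); [exact I| | |].
    + intros u [Hu _]. assert (He := exp_pos (- u)).
      replace (M + 2 - 1) with (M + 1) by ring. replace (M + 1 - 1) with M by ring.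
      rewrite Rpower_plus, Rpower_1 by exact Hu.
      replace (c - 1) with ((c - (M + 2)) + (M + 1)) by ring.
      rewrite (Rpower_plus _ _ u), (Rpower_plus _ _ u), Rpower_1 by exact Hu.
      assert (HuM := Rpower_pos u M). assert (HM := Rpower_pos M (c - (M + 2))).
      assert (Huc := Rpower_pos u (c - (M + 2))).
      replace (Rpower M (c - (M + 2)) * (Rpower u M * u * exp (- u) +
        - M * (Rpower u M * exp (- u))))
        with (Rpower M (c - (M + 2)) * (u - M) * (Rpower u M * exp (- u))) by ring.
      replace (Rpower u (c - (M + 2)) * (Rpower u M * u) * exp (- u))
        with (Rpower u (c - (M + 2)) * u * (Rpower u M * exp (- u))) by ring.
      apply Rmult_le_compat_r; [apply Rmult_le_pos; lra|].
      destruct (Rle_lt_dec u M) as [H|H]; [nra|].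
      assert (Rpower M (c - (M + 2)) <= Rpower u (c - (M + 2)))
        by (apply Rle_Rpower_l; lra).
      apply Rmult_le_compat; lra.
    + apply Rint_scal, Rint_plus; [|apply Rint_scal]; apply Rint_GammaR; lra.
    + apply Rint_GammaR; lra.
Qed.

Lemma GammaR_pos c : 0 < c -> 0 < GammaR c.
Proof.
  intros Hc. destruct (INR_unbounded (3 - c)) as [n Hn].
  assert (H : 3 <= c + INR n) by lra. clear Hn. revert c Hc H.
  induction n as [|n IH]; intros c Hc H.
  - simpl in H. eapply Rlt_le_trans; [|apply (GammaR_growth 1); [lia| simpl; lra]].
    apply Rpower_pos.
  - rewrite S_INR in H. specialize (IH (c + 1) ltac:(lra) ltac:(lra)).
    rewrite GammaR_S in IH by exact Hc. nra.
Qed.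

Lemma Rsqr_sin_le x : Rsqr (sin x) <= Rsqr x.
Proof.
  assert (H : forall h, 0 <= h -> Rsqr (sin h) <= Rsqr h).
  { intros h Hh. apply Rsqr_le_abs_1. rewrite (Rabs_pos_eq h Hh).
    destruct (Rle_lt_dec h PI) as [Hpi|Hpi].
    - rewrite Rabs_pos_eq by (apply sin_ge_0; assumption).
      destruct Hh as [Hh|<-]; [left; apply sin_lt_x, Hh| rewrite sin_0; lra].
    - generalize (SIN_bound h) PI2_1. intros ? ?. apply Rabs_le. lra. }
  destruct (Rle_lt_dec 0 x) as [H0|H0]; [apply H, H0|].
  rewrite (Rsqr_neg (sin _)), (Rsqr_neg x), <- sin_neg. apply H. lra.
Qed.

Lemma cos_ge_quadratic x : 1 - x ^ 2 / 2 <= cos x.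
Proof.
  assert (Hs := Rsqr_sin_le (x / 2)).
  replace (cos x) with (cos (2 * (x / 2))) by (f_equal; field).
  rewrite cos_2a_sin. unfold Rsqr in Hs. nra.
Qed.

(** For v >= 1 put s = sqrt v: the right-hand side is (2 (s - 1/s))^2, and
    0 <= ln v = 2 ln s <= 2 (s - 1) <= 2 (s - 1/s).  Both sides are invariant
    under v -> 1/v. *)
Lemma ln_sqr_le v : 0 < v -> ln v ^ 2 <= 4 * (v - 2 + / v).
Proof.
  assert (H : forall w, 1 <= w -> ln w ^ 2 <= 4 * (w - 2 + / w)).
  { intros w Hw. set (s := sqrt w).
    assert (Hs : 1 <= s) by (rewrite <- sqrt_1; apply sqrt_le_1; lra).
    assert (E : w = s * s) by (symmetry; apply sqrt_sqrt; lra).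
    rewrite E, ln_mult by lra.
    assert (L0 : 0 <= ln s) by (rewrite <- ln_1; apply ln_le; lra).
    assert (L1 : ln s <= s - / s).
    { generalize (exp_ineq1_le (ln s)). rewrite exp_ln by lra.
      assert (/ s <= 1) by (rewrite <- Rinv_1; apply Rinv_le_contravar; lra). lra. }
    replace (4 * (s * s - 2 + / (s * s))) with (4 * (s - / s) ^ 2) by (field; lra).
    replace ((ln s + ln s) ^ 2) with (4 * ln s ^ 2) by ring.
    apply Rmult_le_compat_l; [lra|]. apply pow_incr; lra. }
  intros Hv. destruct (Rle_lt_dec 1 v) as [H1|H1]; [apply H, H1|].
  assert (H2 : 1 <= / v) by (rewrite <- Rinv_1; apply Rinv_le_contravar; lra).
  specialize (H (/ v) H2). rewrite ln_Rinv, Rinv_inv in H by exact Hv.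
  replace (ln v ^ 2) with ((- ln v) ^ 2) by ring. lra.
Qed.

(** The density u^(c-1) e^(-u) concentrates around u = c, where the
    oscillating factor u^(iy) is nearly the constant c^(iy).  After rotation by
    c^(-iy) the real part of the integrand is governed by the variance of
    ln (u/c), which the moments of u/c and c/u control. *)
Lemma Cmod_Gamma_ge z : 1 < Re z -> 1 + 4 * Im z ^ 2 <= Re z ->
  GammaR (Re z) / 2 <= Cmod (Gamma z).
Proof.
  intros H1 Hy. set (c := Re z) in *. set (y := Im z) in *.
  set (k := Rpowc c (0, - y)).
  assert (Hk : Cmod (Gamma z) = Cmod (k * Gamma z)%C).
  { rewrite Cmod_mult. unfold k. rewrite Cmod_Rpowc. simpl.
    rewrite Rpower_O by lra. ring. }
  rewrite Hk. eapply Rle_trans; [|apply re_le_Cmod].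
  eapply Rle_trans; [|apply Rle_abs].
  assert (HI : Cint (fun u => k * Gamma_integrand z u)%C p_infty (k * Gamma z)%C)
    by (apply Cint_scal; [exact I|]; apply Cint_Gamma; fold c; lra).
  apply Cint_iff in HI. destruct HI as [HI _].
  (* This integrates 1 - (y^2/2) 4 (v - 2 + 1/v) with v = u/c, written as
     1 + 4y^2 - (2y^2/c) u - (2y^2 c)/u. *)
  assert (HJ := Rint_plus _ _ _ _ _ (Rint_scal (1 + 4 * y ^ 2) _ _ _
      (Rint_GammaR c ltac:(lra)))
    (Rint_plus _ _ _ _ _
      (Rint_scal (- 2 * y ^ 2 / c) _ _ _ (Rint_GammaR (c + 1) ltac:(lra)))
      (Rint_scal (- 2 * y ^ 2 * c) _ _ _ (Rint_GammaR (c - 1) ltac:(lra))))).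
  refine (Rle_trans _ _ _ _ (Rint_le _ _ p_infty _ _ I _ HJ HI)).
  - rewrite GammaR_S by lra.
    assert (HG : GammaR c = (c - 1) * GammaR (c - 1))
      by (rewrite <- GammaR_S by lra; f_equal; ring).
    assert (H0 := GammaR_pos (c - 1) ltac:(lra)).
    rewrite HG. apply Rminus_le_0.
    replace (_ - _) with (GammaR (c - 1) * ((c - 1) / 2 - 2 * y ^ 2)) by (field; lra).
    apply Rmult_le_pos; lra.
  - intros u [Hu _]. cbv beta.
    assert (He := exp_pos (- u)). assert (Hp := Rpower_pos u (c - 1)).
    assert (E : Re (k * Gamma_integrand z u)%C =
      Rpower u (c - 1) * exp (- u) * cos (y * (ln u - ln c))).
    { unfold k, Gamma_integrand, Rpowc, Rpower.
      rewrite Re_minus, Im_minus. fold c y. simpl.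
      rewrite Rmult_0_l, exp_0.
      replace (- y * ln c) with (- (y * ln c)) by ring.
      replace (y - 0) with y by ring. replace (y * (ln u - ln c)) with (y * ln u - y * ln c) by ring.
      rewrite cos_minus, cos_neg, sin_neg. ring. }
    rewrite E.
    replace (c + 1 - 1) with ((c - 1) + 1) by ring. rewrite Rpower_plus, Rpower_1 by exact Hu.
    rewrite (Rpower_minus_1 u (c - 1)) by exact Hu.
    assert (Hq := cos_ge_quadratic (y * (ln u - ln c))).
    assert (Hl := ln_sqr_le (u / c) ltac:(apply Rdiv_lt_0_compat; lra)).
    rewrite ln_div in Hl by lra.
    apply Rle_trans with (Rpower u (c - 1) * exp (- u) *
      (1 - y ^ 2 * (4 * (u / c - 2 + / (u / c))) / 2)).
    + right. field. lra.
    + apply Rmult_le_compat_l; [apply Rmult_le_pos; lra|].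
      eapply Rle_trans; [|exact Hq]. rewrite Rpow_mult_distr.
      assert (Hy2 := pow2_ge_0 y). nra.
Qed.

(** A zero would propagate by the functional equation to z + n, where the lower
    bound excludes it for large n. *)
Lemma Gamma_neq_0 z : 0 < Re z -> Gamma z <> 0.
Proof.
  intros Hz. destruct (INR_unbounded (2 + 4 * Im z ^ 2 - Re z)) as [n Hn].
  assert (H : 2 + 4 * Im z ^ 2 <= Re z + INR n) by lra. clear Hn. revert z Hz H.
  induction n as [|n IH]; intros z Hz H.
  - simpl in H. apply Cmod_gt_0.
    assert (H0 := pow2_ge_0 (Im z)).
    generalize (Cmod_Gamma_ge z ltac:(lra) ltac:(lra)) (GammaR_pos (Re z) Hz). lra.
  - rewrite S_INR in H. intros H0. apply (IH (z + 1)%C).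
    + rewrite Re_plus; simpl; lra.
    + rewrite Re_plus, Im_plus. simpl in *. rewrite Rplus_0_r. lra.
    + rewrite Gamma_S, H0 by exact Hz. ring.
Qed.

(** By the two lower bounds, 1/|Gamma(w)| is at most a multiple of m^(-Re w)
    once Re w is large; along the progression this is geometric with ratio
    m^(-a), and m is free. *)
Lemma rGamma_summable z a q : 0 < Re z -> 0 < a -> 0 <= q ->
  ex_series (fun j => q ^ j * Cmod (rGamma (z + a * INR j))).
Proof.
  intros Hz Ha Hq.
  assert (Hlarge : forall A, exists J, forall j, (J <= j)%nat -> A <= a * INR j).
  { intros A. destruct (INR_archimed a A Ha) as [J HJ]. exists J. intros j Hj.
    apply le_INR in Hj. nra. }
  (* m is chosen with m^a > q. *)
  destruct (INR_unbounded (Rpower (q + 1) (/ a) + 1)) as [m Hm].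
  assert (Hm0 := Rpower_pos (q + 1) (/ a)).
  assert (Hm1 : (1 <= m)%nat) by (apply INR_le; simpl; lra).
  set (M := INR m) in *.
  assert (HMa : q < Rpower M a).
  { apply Rlt_trans with (q + 1); [lra|].
    replace (q + 1) with (Rpower (Rpower (q + 1) (/ a)) a) at 1
      by (rewrite Rpower_mult, Rinv_l, Rpower_1; lra).
    apply Rlt_Rpower_l; lra. }
  assert (HMp := Rpower_pos M a).
  destruct (Hlarge (M + 4 + 4 * Im z ^ 2)) as [J HJ].
  apply (ex_series_incr_n _ J).
  set (r := q / Rpower M a).
  assert (Hr : 0 <= r < 1).
  { unfold r. split; [apply Rdiv_le_0_compat; lra|]. apply Rlt_div_l; lra. }
  apply (ex_series_le (V := R_CompleteNormedModule) _
    (fun j => (2 * Rpower M (M + 2 - Re z) * r ^ J) * r ^ j)).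
  2: { apply (ex_series_scal_l (V := R_NormedModule)).
       eexists; apply is_series_geom. rewrite Rabs_pos_eq; lra. }
  intros j. unfold norm; simpl; unfold abs; simpl.
  set (n := (J + j)%nat). specialize (HJ n ltac:(unfold n; lia)).
  set (w := (z + a * INR n)%C).
  assert (Hw : Re w = Re z + a * INR n) by (unfold w; rewrite Re_plus, re_mult; simpl; ring).
  assert (Iw : Im w = Im z) by (unfold w; rewrite Im_plus, im_mult; simpl; ring).
  assert (H0 := pow2_ge_0 (Im z)).
  assert (HM0 : 1 <= M) by (apply le_INR in Hm1; exact Hm1).
  rewrite rGamma_Re_pos by lra.
  rewrite Cmod_inv by (apply Gamma_neq_0; lra).
  assert (HG := Cmod_Gamma_ge w ltac:(lra) ltac:(rewrite Iw; lra)).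
  assert (HG2 := GammaR_growth m (Re w) Hm1 ltac:(fold M; lra)). fold M in HG2.
  assert (HP := Rpower_pos M (Re w - (M + 2))).
  rewrite Rabs_pos_eq.
  2: { apply Rmult_le_pos; [apply pow_le, Hq|]. left; apply Rinv_0_lt_compat. lra. }
  apply Rle_trans with (q ^ n * / (Rpower M (Re w - (M + 2)) / 2)).
  { apply Rmult_le_compat_l; [apply pow_le, Hq|]. apply Rinv_le_contravar; lra. }
  right. rewrite Rmult_assoc, <- pow_add. fold n. unfold r.
  replace (Re w - (M + 2)) with (a * INR n + - (M + 2 - Re z)) by lra.
  rewrite Rpower_plus, Rpower_Ropp, <- Rpower_mult, Rpower_pow by apply Rpower_pos.
  unfold Rdiv. rewrite Rpow_mult_distr, pow_inv.
  field. repeat split; try apply pow_nonzero; try lra; apply Rgt_not_eq, Rpower_pos.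
Qed.
(** * The Beta integral *)

Lemma Rpower_1_l e : Rpower 1 e = 1.
Proof. unfold Rpower. rewrite ln_1, Rmult_0_r. apply exp_0. Qed.

Lemma Rpower_le_middle v e : 1 / 2 <= v <= 1 -> Rpower v e <= 1 + Rpower (1 / 2) e.
Proof.
  intros Hv. assert (Hp := Rpower_pos (1 / 2) e).
  destruct (Rle_lt_dec 0 e) as [He|He].
  - assert (Rpower v e <= Rpower 1 e) by (apply Rle_Rpower_l; lra).
    rewrite Rpower_1_l in *. lra.
  - assert (Rpower v e <= Rpower (1 / 2) e); [|lra].
    replace e with (- - e) by ring. rewrite !(Rpower_Ropp _ (- e)).
    apply Rinv_le_contravar; [apply Rpower_pos|]. apply Rle_Rpower_l; lra.
Qed.

Lemma Rint_power_0 c : 0 < c -> Rint (fun u => Rpower u (c - 1)) 1 (/ c).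
Proof.
  intros Hc.
  enough (H : Rint (fun u => / c * (c * Rpower u (c - 1))) 1 (/ c * (1 - 0))).
  { eapply Rint_replace; [| | |exact H]; [simpl; lra| |ring].
    intros u _. cbv beta. field. lra. }
  apply Rint_scal, (Rint_FTC (fun u => Rpower u c)); [simpl; lra| | |apply Rpower_lim_0, Hc|].
  - intros u [Hu _]. rewrite Rpower_minus_1 by exact Hu. unfold Rpower.
    auto_derive; [exact Hu|]. field. lra.
  - intros u [Hu _]. apply (ex_derive_continuous (V := R_NormedModule)).
    unfold Rpower. auto_derive. exact Hu.
  - assert (H : continuous (fun u => Rpower u c) 1).
    { apply (ex_derive_continuous (V := R_NormedModule)).
      unfold Rpower. auto_derive. lra. }
    unfold continuous in H. rewrite Rpower_1_l in H.
    intros P HP. apply filter_le_within, H, HP.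
Qed.

Lemma Rint_power_1 c : 0 < c -> Rint (fun u => Rpower (1 - u) (c - 1)) 1 (/ c).
Proof.
  intros Hc.
  enough (H : Rint (fun u => - / c * (- (c * Rpower (1 - u) (c - 1)))) 1 (- / c * (0 - 1))).
  { eapply Rint_replace; [| | |exact H]; [simpl; lra| |ring].
    intros u _. cbv beta. field. lra. }
  apply Rint_scal, (Rint_FTC (fun u => Rpower (1 - u) c));
    [simpl; lra| | | |apply Rpower_sub_lim_0, Hc].
  - intros u [_ Hu]. simpl in Hu. rewrite Rpower_minus_1 by lra. unfold Rpower.
    auto_derive; [lra|]. change (1 + - u) with (1 - u). field. lra.
  - intros u [_ Hu]. simpl in Hu. apply (ex_derive_continuous (V := R_NormedModule)).
    unfold Rpower. auto_derive. lra.
  - assert (H : continuous (fun u => Rpower (1 - u) c) 0).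
    { apply (ex_derive_continuous (V := R_NormedModule)).
      unfold Rpower. auto_derive. lra. }
    unfold continuous in H. rewrite Rminus_0_r, Rpower_1_l in H.
    intros P HP. apply filter_le_within, H, HP.
Qed.

(** Near each endpoint only one of the two factors is singular, and the other
    is bounded. *)
Lemma Rint_Beta_ex c d : 0 < c -> 0 < d ->
  exists D, Rint (fun u => Rpower (1 - u) (c - 1) * Rpower u (d - 1)) 1 D.
Proof.
  intros Hc Hd.
  set (K := 1 + Rpower (1 / 2) (c - 1)). set (L := 1 + Rpower (1 / 2) (d - 1)).
  apply (Rint_dominated _ (fun u => K * Rpower u (d - 1) + L * Rpower (1 - u) (c - 1))
    1 (K * / d + L * / c)); [simpl; lra| | |].
  - intros u [Hu0 Hu1]. simpl in Hu1. apply (ex_derive_continuous (V := R_NormedModule)).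
    unfold Rpower. auto_derive. lra.
  - intros u [Hu0 Hu1]. simpl in Hu1.
    assert (A := Rpower_pos (1 - u) (c - 1)). assert (B := Rpower_pos u (d - 1)).
    assert (A2 := Rpower_pos (1 / 2) (c - 1)). assert (B2 := Rpower_pos (1 / 2) (d - 1)).
    rewrite Rabs_pos_eq by (apply Rmult_le_pos; lra).
    destruct (Rle_lt_dec u (1 / 2)) as [H|H].
    + generalize (Rpower_le_middle (1 - u) (c - 1) ltac:(lra)). fold K. intros H1.
      assert (0 <= L * Rpower (1 - u) (c - 1)) by (apply Rmult_le_pos; unfold L; lra).
      apply Rmult_le_compat_r with (r := Rpower u (d - 1)) in H1; lra.
    + generalize (Rpower_le_middle u (d - 1) ltac:(lra)). fold L. intros H1.
      assert (0 <= K * Rpower u (d - 1)) by (apply Rmult_le_pos; unfold K; lra).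
      apply Rmult_le_compat_r with (r := Rpower (1 - u) (c - 1)) in H1; lra.
  - apply Rint_plus; apply Rint_scal; [apply Rint_power_0|apply Rint_power_1]; assumption.
Qed.

Definition Beta_integrand (t : R) (p q : C) (u : R) : C :=
  (Rpowc (t - u) (p - 1) * Rpowc u (q - 1))%C.

Definition Beta (p q : C) : C :=
  RInt_gen (V := C_R_CompleteNormedModule) (Beta_integrand 1 p q)
    (at_right 0) (at_left 1).

Lemma Beta_integrand_cont (t : R) p q u : inside t u -> Ccont (Beta_integrand t p q) u.
Proof.
  intros [H0 H1]. simpl in H1.
  apply Ccont_mult; [apply Ccont_Rpowc_sub, H1| apply Ccont_Rpowc, H0].
Qed.

Lemma Cmod_Beta_integrand t p q u :
  Cmod (Beta_integrand t p q u) = Rpower (t - u) (Re p - 1) * Rpower u (Re q - 1).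
Proof.
  unfold Beta_integrand. rewrite Cmod_mult, !Cmod_Rpowc, !Re_minus. reflexivity.
Qed.

Lemma Cint_Beta p q : 0 < Re p -> 0 < Re q -> Cint (Beta_integrand 1 p q) 1 (Beta p q).
Proof.
  intros Hp Hq. destruct (Rint_Beta_ex _ _ Hp Hq) as [D HD].
  destruct (Cint_dominated (Beta_integrand 1 p q) _ 1 D ltac:(simpl; lra)
    (Beta_integrand_cont 1 p q)
    (fun u _ => Req_le _ _ (Cmod_Beta_integrand 1 p q u)) HD) as (l & Hl & _).
  exact (RInt_gen_correct (V := C_R_CompleteNormedModule)
      (Fa := at_right 0) (Fb := at_left 1) (Beta_integrand 1 p q) (ex_intro _ l Hl)).
Qed.

(** The derivative of (1-u)^p u^q is (1-u)^(p-1) u^(q-1) ((p+q)(1-u) - p), and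
    its integral vanishes with the boundary values. *)
Lemma Beta_S p q : 0 < Re p -> 0 < Re q ->
  ((p + q) * Beta (p + 1) q = p * Beta p q)%C.
Proof.
  intros Hp Hq.
  assert (Hp1 : 0 < Re (p + 1)) by (rewrite Re_plus; simpl; lra).
  set (h := fun u => ((p + q) * Beta_integrand 1 (p + 1) q u
    - p * Beta_integrand 1 p q u)%C).
  assert (H1 : Cint h 1 ((p + q) * Beta (p + 1) q - p * Beta p q)%C).
  { apply Cint_minus; [simpl; lra| |]; (apply Cint_scal; [simpl; lra|]);
      apply Cint_Beta; assumption. }
  assert (Hmod : forall u, Cmod (Rpowc (1 - u) p * Rpowc u q)%C
    = Rpower (1 - u) (Re p) * Rpower u (Re q))
    by (intros u; rewrite Cmod_mult, !Cmod_Rpowc; reflexivity).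
  assert (Hle : forall v c, 0 < c -> 0 < v <= 1 -> 0 < Rpower v c <= 1).
  { intros v c Hc Hv. split; [apply Rpower_pos|]. rewrite <- (Rpower_1_l c).
    apply Rle_Rpower_l; lra. }
  assert (H2 : Cint h 1 (0 - 0)%C).
  { apply (Cint_FTC (fun u => Rpowc (1 - u) p * Rpowc u q)%C).
    - simpl; lra.
    - intros u [Hu0 Hu1]. simpl in Hu1.
      assert (H := Cder_mult _ _ u _ _ (Cder_Rpowc_sub 1 p u Hu1) (Cder_Rpowc q u Hu0)).
      evar (l : C). replace (h u) with l; [exact H|].
      unfold l, h, Beta_integrand. replace (p + 1 - 1)%C with p by ring.
      rewrite (Rpowc_minus_1 (1 - u) p), (Rpowc_minus_1 u q) by lra.
      rewrite RtoC_minus. ring.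
    - intros u Hu.
      apply Ccont_minus; apply Ccont_mult; try apply Ccont_const;
        apply Beta_integrand_cont, Hu.
    - apply (Clim_0 _ (fun u => Rpower u (Re q)) (at_right 0)); [|apply Rpower_lim_0, Hq].
      generalize (at_right_inside 1 ltac:(simpl; lra)). apply filter_imp.
      intros u [Hu0 Hu1]. simpl in Hu1. rewrite Hmod.
      assert (A := Hle (1 - u) (Re p) Hp ltac:(lra)). assert (B := Rpower_pos u (Re q)).
      nra.
    - apply (Clim_0 _ (fun u => Rpower (1 - u) (Re p)) (at_left 1));
        [|apply Rpower_sub_lim_0, Hp].
      generalize (left_of_inside 1 ltac:(simpl; lra)). apply filter_imp.
      intros u [Hu0 Hu1]. simpl in Hu1. rewrite Hmod.
      assert (A := Hle u (Re q) Hq ltac:(lra)). assert (B := Rpower_pos (1 - u) (Re p)).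
      nra. }
  generalize (Cint_unique _ _ _ _ H1 H2). intros H.
  replace ((p + q) * Beta (p + 1) q)%C with
    ((p + q) * Beta (p + 1) q - p * Beta p q + p * Beta p q)%C by ring.
  rewrite H. ring.
Qed.

Lemma Re_pos_neq_0 z : 0 < Re z -> z <> 0.
Proof. intros H E. rewrite E in H. simpl in H. lra. Qed.

Lemma Beta_1_l q : 0 < Re q -> Beta 1 q = (/ q)%C.
Proof.
  intros Hq. assert (Hq0 := Re_pos_neq_0 q Hq).
  eapply Cint_unique; [apply Cint_Beta; [simpl; lra| exact Hq]|].
  enough (H : Cint (fun u => / q * (q * Rpowc u (q - 1)))%C 1 (/ q * (1 - 0))%C).
  { eapply Cint_replace; [| | |exact H]; [simpl; lra| |ring].
    intros u _. unfold Beta_integrand. replace (1 - 1)%C with (RtoC 0) by ring.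
    rewrite Rpowc_0. field. exact Hq0. }
  apply Cint_scal; [simpl; lra|].
  apply (Cint_FTC (fun u => Rpowc u q)); [simpl; lra| | | |].
  - intros u [Hu _]. apply Cder_Rpowc, Hu.
  - intros u [Hu _]. apply Ccont_mult; [apply Ccont_const| apply Ccont_Rpowc, Hu].
  - apply (Clim_0 _ (fun u => Rpower u (Re q)) (at_right 0)); [|apply Rpower_lim_0, Hq].
    apply filter_forall. intros u. rewrite Cmod_Rpowc. lra.
  - destruct (Ccont_Rpowc q 1 ltac:(lra)) as [H1 H2].
    unfold continuous in H1, H2. rewrite Rpowc_base_1 in H1, H2.
    split; intros P HP; apply filter_le_within; [apply H1| apply H2]; exact HP.
Qed.

(** ** Change of scale *)

Lemma Rint_scale f t l : 0 < t -> Rint f 1 l -> Rint (fun u => f (u / t)) t (t * l).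
Proof.
  intros Ht H.
  enough (H' : Rint (fun u => / t * f (u / t)) t l).
  { eapply Rint_replace; [| | |exact (Rint_scal t _ _ _ H')];
      [exact Ht| intros u _; cbv beta; field; lra| reflexivity]. }
  unfold Rint, is_RInt_gen in *. rewrite filterlimi_locally in H.
  apply filterlimi_locally.
  intros eps. destruct (H eps) as [Q1 Q2 H1 H2 HQ].
  assert (E : forall u a, u / t - a = (u - a * t) / t) by (intros; field; lra).
  apply Filter_prod with (fun x => Q1 (x / t)) (fun y => Q2 (y / t)).
  - destruct H1 as [d Hd]. assert (Hdt : 0 < d * t)
      by (apply Rmult_lt_0_compat; [apply cond_pos| exact Ht]).
    exists (mkposreal _ Hdt). intros u Hu H0. apply Hd.
    + change (Rabs (u - 0) < d * t) in Hu. change (Rabs (u / t - 0) < d).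
      rewrite E, Rabs_div, (Rabs_pos_eq t) by lra. rewrite Rmult_0_l.
      apply Rlt_div_l; lra.
    + apply Rdiv_lt_0_compat; lra.
  - destruct H2 as [d Hd]. assert (Hdt : 0 < d * t)
      by (apply Rmult_lt_0_compat; [apply cond_pos| exact Ht]).
    exists (mkposreal _ Hdt). intros u Hu H0. apply Hd.
    + change (Rabs (u - t) < d * t) in Hu. change (Rabs (u / t - 1) < d).
      rewrite E, Rabs_div, (Rabs_pos_eq t) by lra. rewrite Rmult_1_l.
      apply Rlt_div_l; lra.
    + apply Rlt_div_l; lra.
  - intros x y Hx Hy. destruct (HQ _ _ Hx Hy) as (z & Hz & Hb).
    exists z. split; [|exact Hb]. simpl in *.
    apply (is_RInt_ext (V := R_NormedModule)
      (fun u => scal (/ t) (f (/ t * u + 0)))).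
    { intros u _. unfold scal; simpl; unfold mult; simpl. do 2 f_equal. field. lra. }
    apply (is_RInt_comp_lin (V := R_NormedModule)).
    replace (/ t * x + 0) with (x / t) by (field; lra).
    replace (/ t * y + 0) with (y / t) by (field; lra). exact Hz.
Qed.

Lemma Cint_scale f t l : 0 < t ->
  Cint f 1 l -> Cint (fun u => f (u / t)) t (t * l)%C.
Proof.
  intros Ht. rewrite !Cint_iff. rewrite re_scal_l. intros [H1 H2]. split.
  - exact (Rint_scale _ t _ Ht H1).
  - replace (Im (t * l)%C) with (t * Im l) by (rewrite im_mult; simpl; ring).
    exact (Rint_scale _ t _ Ht H2).
Qed.

Lemma Cint_Beta_scaled t p q : 0 < t -> 0 < Re p -> 0 < Re q ->
  Cint (Beta_integrand t p q) t (Rpowc t (p + q - 1) * Beta p q)%C.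
Proof.
  intros Ht Hp Hq.
  eapply Cint_replace; [| | |apply (Cint_scal (Rpowc t (p - 1) * Rpowc t (q - 1))%C);
    [|exact (Cint_scale _ t _ Ht (Cint_Beta p q Hp Hq))]]; try exact Ht.
  - intros u [Hu0 Hu1]. simpl in Hu1. unfold Beta_integrand.
    assert (0 < u / t) by (apply Rdiv_lt_0_compat; lra).
    assert (u / t < 1) by (apply Rlt_div_l; lra).
    replace (t - u) with (t * (1 - u / t)) by (field; lra).
    replace (Rpowc u (q - 1)) with (Rpowc (t * (u / t)) (q - 1))
      by (f_equal; field; lra).
    rewrite !Rpowc_mult_base by lra. ring.
  - replace (p + q - 1)%C with ((p - 1) + (q - 1) + 1)%C by ring.
    rewrite !Rpowc_plus, Rpowc_1 by exact Ht. ring.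
Qed.

Lemma Rint_Beta_scaled_ex t c d : 0 < t -> 0 < c -> 0 < d ->
  exists D, Rint (fun u => Rpower (t - u) (c - 1) * Rpower u (d - 1)) t D.
Proof.
  intros Ht Hc Hd. destruct (Rint_Beta_ex c d Hc Hd) as [D HD]. eexists.
  eapply Rint_replace; [exact Ht| |reflexivity|
    exact (Rint_scal (Rpower t (c - 1) * Rpower t (d - 1)) _ _ _
      (Rint_scale _ t _ Ht HD))].
  intros u [Hu0 Hu1]. simpl in Hu1. cbv beta.
  assert (0 < u / t) by (apply Rdiv_lt_0_compat; lra).
  assert (u / t < 1) by (apply Rlt_div_l; lra).
  replace (t - u) with (t * (1 - u / t)) by (field; lra).
  replace (Rpower u (d - 1)) with (Rpower (t * (u / t)) (d - 1))
    by (f_equal; field; lra).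
  rewrite <- !Rpower_mult_distr by lra. ring.
Qed.
(** * Beta in terms of Gamma *)

(** An integral over (0, t) is compared with one over (0, oo) by a majorant
    that controls the difference on (0, t) and the remaining tail.  Asking for
    the tail bound already beyond t/2 allows the endpoint t to be approached
    from the left. *)
Lemma Cint_compare (f g : R -> C) (d : R -> R) t l1 l2 D : 0 < t ->
  Cint f t l1 -> Cint g p_infty l2 -> Rint d p_infty D ->
  (forall u, 0 < u < t -> Cmod (f u - g u)%C <= d u) ->
  (forall u, t / 2 < u -> Cmod (g u) <= d u) ->
  Cmod (l1 - l2)%C <= D.
Proof.
  intros Ht Hf Hg Hd Hfg Hgd.
  apply le_epsilon. intros eps Heps.
  assert (He : 0 < eps / 5) by lra. set (e := mkposreal _ He).
  unfold Cint, Rint, is_RInt_gen in *.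
  rewrite filterlimi_locally in Hf.
  rewrite filterlimi_locally in Hg.
  rewrite filterlimi_locally in Hd.
  destruct (Hf e) as [P1 P2 HP1 HP2 HP].
  destruct (Hg e) as [Q1 Q2 HQ1 HQ2 HQ].
  destruct (Hd e) as [S1 S2 HS1 HS2 HS].
  destruct (filter_ex (F := at_right 0) _ (filter_and _ _ (filter_and _ _ HP1 HQ1)
    (filter_and _ _ HS1 (at_right_inside (t / 2) ltac:(simpl; lra)))))
    as [x [[Px Qx] [Sx [Hx0 Hxt]]]]. simpl in Hxt.
  assert (Hmid : at_left t (fun y => t / 2 < y /\ y < t)).
  { unfold at_left, within. eapply filter_imp; [|apply (open_gt (t / 2) t); lra].
    intros; split; assumption. }
  destruct (filter_ex (F := at_left t) _ (filter_and _ _ HP2 Hmid)) as [y [Py [Hy1 Hy2]]].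
  assert (Hbig : Rbar_locally p_infty (fun Y => t < Y)) by (exists t; tauto).
  destruct (filter_ex (F := Rbar_locally p_infty) _ (filter_and _ _ (filter_and _ _ HQ2 HS2)
    Hbig)) as [Y [[QY SY] HY]].
  destruct (HP x y Px Py) as (z1 & I1 & [B1 B1']).
  destruct (HQ x Y Qx QY) as (z2 & I2 & [B2 B2']).
  destruct (HS x Y Sx SY) as (z3 & I3 & B3). simpl in I1, I2, I3.
  change (Rabs (Re z1 - Re l1) < eps / 5) in B1.
  change (Rabs (Im z1 - Im l1) < eps / 5) in B1'.
  change (Rabs (Re z2 - Re l2) < eps / 5) in B2.
  change (Rabs (Im z2 - Im l2) < eps / 5) in B2'.
  change (Rabs (z3 - D) < eps / 5) in B3.
  assert (Hxy : x <= y <= Y) by lra.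
  destruct (ex_RInt_Chasles_1 (V := C_R_CompleteNormedModule) g x y Y Hxy
    (ex_intro _ z2 I2)) as [g1 G1].
  destruct (ex_RInt_Chasles_2 (V := C_R_CompleteNormedModule) g x y Y Hxy
    (ex_intro _ z2 I2)) as [g2 G2].
  destruct (ex_RInt_Chasles_1 (V := R_CompleteNormedModule) d x y Y Hxy
    (ex_intro _ z3 I3)) as [d1 D1].
  destruct (ex_RInt_Chasles_2 (V := R_CompleteNormedModule) d x y Y Hxy
    (ex_intro _ z3 I3)) as [d2 D2].
  assert (Eg : z2 = (g1 + g2)%C).
  { rewrite <- (is_RInt_unique (V := C_R_CompleteNormedModule) _ _ _ _ I2).
    exact (is_RInt_unique (V := C_R_CompleteNormedModule) _ _ _ _
      (is_RInt_Chasles (V := C_R_NormedModule) g x y Y g1 g2 G1 G2)). }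
  assert (Ed : z3 = d1 + d2).
  { rewrite <- (is_RInt_unique (V := R_CompleteNormedModule) _ _ _ _ I3).
    exact (is_RInt_unique (V := R_CompleteNormedModule) _ _ _ _
      (is_RInt_Chasles (V := R_NormedModule) d x y Y d1 d2 D1 D2)). }
  assert (N1 : Cmod (z1 - g1)%C <= d1).
  { rewrite <- norm_C_R.
    apply (norm_RInt_le (V := C_R_NormedModule) (fun u => f u - g u)%C d x y);
      [lra| |exact (is_RInt_minus (V := C_R_NormedModule) f g x y z1 g1 I1 G1)| exact D1].
    intros u Hu. eapply Rle_trans; [right; apply norm_C_R|]. apply Hfg. lra. }
  assert (N2 : Cmod g2 <= d2).
  { rewrite <- norm_C_R.
    apply (norm_RInt_le (V := C_R_NormedModule) g d y Y); [lra| |exact G2| exact D2].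
    intros u Hu. eapply Rle_trans; [right; apply norm_C_R|]. apply Hgd. lra. }
  assert (K1 : Cmod (l1 - z1)%C <= eps / 5 + eps / 5).
  { eapply Rle_trans; [apply Cmod_le_Re_Im|]. rewrite Re_minus, Im_minus.
    rewrite (Rabs_minus_sym (Re _)), (Rabs_minus_sym (Im _)). lra. }
  assert (K2 : Cmod (z2 - l2)%C <= eps / 5 + eps / 5).
  { eapply Rle_trans; [apply Cmod_le_Re_Im|]. rewrite Re_minus, Im_minus. lra. }
  apply Rabs_def2 in B3.
  replace (l1 - l2)%C with ((l1 - z1) + ((z1 - g1) + (- g2 + (z2 - l2))))%C
    by (rewrite Eg; ring).
  eapply Rle_trans; [apply Cmod_triangle|].
  eapply Rle_trans; [apply Rplus_le_compat_l, Cmod_triangle|].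
  eapply Rle_trans; [apply Rplus_le_compat_l, Rplus_le_compat_l, Cmod_triangle|].
  rewrite Cmod_opp. lra.
Qed.

Lemma exp_pow x m : exp x ^ m = exp (INR m * x).
Proof.
  rewrite <- Rpower_pow by apply exp_pos. unfold Rpower. rewrite ln_exp. reflexivity.
Qed.

Lemma Bernoulli_neg x m : 0 <= x <= 1 -> 1 - INR m * x <= (1 - x) ^ m.
Proof.
  intros Hx. induction m as [|m IH]; [simpl; lra|].
  rewrite S_INR. simpl. assert (Hm := pos_INR m).
  apply Rle_trans with ((1 - x) * (1 - INR m * x)); [|apply Rmult_le_compat_l; lra].
  assert (0 <= INR m * x * x) by (apply Rmult_le_pos; [apply Rmult_le_pos|]; lra). lra.
Qed.

(** The second inequality compares e^(ms) (1-s)^m with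
    (1+s)^m (1-s)^m = (1-s^2)^m >= 1 - m s^2. *)
Lemma exp_pow_compare s m : 0 <= s <= 1 ->
  0 <= exp (- (INR m * s)) - (1 - s) ^ m <= INR m * s ^ 2 * exp (- (INR m * s)).
Proof.
  intros Hs.
  assert (E1 : (1 - s) ^ m <= exp (- (INR m * s))).
  { replace (- (INR m * s)) with (INR m * - s) by ring. rewrite <- exp_pow.
    apply pow_incr. generalize (exp_ineq1_le (- s)). lra. }
  assert (E2 : 1 - INR m * s ^ 2 <= (1 - s) ^ m * exp (INR m * s)).
  { eapply Rle_trans; [apply Bernoulli_neg; split; nra|].
    replace (1 - s ^ 2) with ((1 - s) * (1 + s)) by ring. rewrite Rpow_mult_distr.
    apply Rmult_le_compat_l; [apply pow_le; lra|]. rewrite <- exp_pow.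
    apply pow_incr. generalize (exp_ineq1_le s). lra. }
  split; [lra|].
  apply (Rmult_le_compat_r (exp (- (INR m * s)))) in E2; [|left; apply exp_pos].
  rewrite Rmult_assoc, <- exp_plus, Rplus_opp_r, exp_0 in E2. lra.
Qed.

(** For s >= 1/2 the left-hand side is at most 2 <= 4 s.  For s < 1/2 one has
    |ln (1-s)| <= 2 s, and |e^w - 1| <= |Re w| + 2 |Im w| <= 3 |w| for
    w = q ln (1-s), whose real part is not positive. *)
Lemma Rpowc_near_1 q s : 0 <= Re q -> 0 < s < 1 ->
  Cmod (Rpowc (1 - s) q - 1)%C <= (6 * Cmod q + 4) * s.
Proof.
  intros Hq Hs. assert (Hc := Cmod_ge_0 q).
  assert (L0 : ln (1 - s) <= 0) by (rewrite <- ln_1; apply ln_le; lra).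
  assert (H1 : Cmod (Rpowc (1 - s) q) <= 1).
  { rewrite Cmod_Rpowc. apply Rle_trans with (exp 0); [|rewrite exp_0; lra].
    apply exp_incr_le. nra. }
  destruct (Rle_lt_dec (1 / 2) s) as [H|H].
  - unfold Cminus. eapply Rle_trans; [apply Cmod_triangle|].
    rewrite Cmod_opp, Cmod_1. nra.
  - assert (L1 : - (2 * s) <= ln (1 - s)).
    { generalize (exp_ineq1_le (ln (/ (1 - s)))).
      rewrite exp_ln by (apply Rinv_0_lt_compat; lra). rewrite ln_Rinv by lra.
      assert (/ (1 - s) <= 1 + 2 * s); [|lra].
      apply Rle_trans with (1 / (1 - s)); [lra|]. apply Rle_div_l; nra. }
    assert (Ra := re_le_Cmod q). assert (Rb := Im_le_Cmod q).
    eapply Rle_trans; [apply Cmod_le_Re_Im|].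
    rewrite Re_minus, Im_minus. simpl (Re 1). simpl (Im 1). rewrite Rminus_0_r.
    unfold Rpowc, Re at 1, Im at 2; simpl.
    set (L := ln (1 - s)) in *. set (A := Re q * L). set (th := Im q * L).
    assert (HL : Rabs L <= 2 * s) by (apply Rabs_le; lra).
    assert (HA : Rabs A <= Cmod q * (2 * s)).
    { unfold A. rewrite Rabs_mult. apply Rmult_le_compat; try apply Rabs_pos; assumption. }
    assert (Hth : Rabs th <= Cmod q * (2 * s)).
    { unfold th. rewrite Rabs_mult. apply Rmult_le_compat; try apply Rabs_pos; assumption. }
    assert (A0 : A <= 0) by (unfold A; nra).
    assert (HeA : exp A <= 1) by (rewrite <- exp_0; apply exp_incr_le, A0).
    assert (HeA1 := exp_ineq1_le A). assert (HeA0 := exp_pos A).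
    rewrite (Rabs_left1 A) in HA by exact A0.
    assert (S1 : Rabs (sin th) <= Rabs th) by (apply Rsqr_le_abs_0, Rsqr_sin_le).
    assert (C1 : 1 - cos th <= Rabs th).
    { generalize (cos_ge_quadratic th) (COS_bound th). intros Q1 Q2.
      assert (P := Rabs_pos th). rewrite <- pow2_abs in Q1.
      destruct (Rle_lt_dec (Rabs th) 2) as [H2|H2]; [nra| lra]. }
    assert (CB := COS_bound th).
    assert (X1 : Rabs (exp A * cos th - 1) <= Cmod q * (4 * s)).
    { apply Rabs_le. split; [|nra].
      replace (exp A * cos th - 1) with (- ((1 - exp A) * cos th) - (1 - cos th)) by ring.
      assert ((1 - exp A) * cos th <= - A) by nra. lra. }
    assert (X2 : Rabs (exp A * sin th) <= Cmod q * (2 * s)).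
    { rewrite Rabs_mult, (Rabs_pos_eq (exp A)) by lra.
      assert (P := Rabs_pos (sin th)). nra. }
    nra.
Qed.

(** With m = n + 1, the substitution s = v/m turns m^p B(q+m+1, p) into the
    integral of (1 - v/m)^(q+m) v^(p-1) over (0, m), whose integrand differs
    from that of Gamma(p) by at most (A v + v^2)/m times v^(Re p - 1) e^(-v). *)
Lemma Beta_approx p q n : 0 < Re p -> 0 < Re q ->
  Cmod (Rpowc (INR (S n)) p * Beta (q + INR (S n) + 1) p - Gamma p)%C <=
  / INR (S n) * ((6 * Cmod q + 4) * GammaR (Re p + 1) + GammaR (Re p + 2)).
Proof.
  intros Hp Hq. set (m := INR (S n)).
  assert (Hm : 1 <= m) by (unfold m; rewrite S_INR; generalize (pos_INR n); lra).
  set (A := 6 * Cmod q + 4). assert (HA : 4 <= A) by (unfold A; generalize (Cmod_ge_0 q); lra).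
  assert (Hqm : 0 < Re (q + m + 1)) by (rewrite !Re_plus; simpl; lra).
  assert (HB := Cint_scal (Rpowc m (- (q + m))) _ m _ (Rlt_le_trans 0 1 m Rlt_0_1 Hm)
    (Cint_Beta_scaled m (q + m + 1) p ltac:(lra) Hqm Hp)).
  replace (Rpowc m (- (q + m)) * (Rpowc m (q + m + 1 + p - 1) * Beta (q + m + 1) p))%C
    with (Rpowc m p * Beta (q + m + 1) p)%C in HB
    by (rewrite Cmult_assoc, <- Rpowc_plus; do 2 f_equal; ring).
  apply (Cint_compare _ (Gamma_integrand p) (fun u => / m *
    (A * (Rpower u (Re p + 1 - 1) * exp (- u)) + Rpower u (Re p + 2 - 1) * exp (- u)))
    m _ _ _ ltac:(lra) HB (Cint_Gamma p Hp)).
  - apply Rint_scal, Rint_plus; [apply Rint_scal|]; apply Rint_GammaR; lra.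
  - intros u [Hu0 Hum]. set (s := u / m).
    assert (Hs : 0 < s < 1).
    { unfold s; split; [apply Rdiv_lt_0_compat; lra| apply Rlt_div_l; lra]. }
    assert (Hms : INR (S n) * s = u) by (unfold s; fold m; field; lra).
    replace (Rpowc m (- (q + m)) * Beta_integrand m (q + m + 1) p u - Gamma_integrand p u)%C
      with (Rpowc u (p - 1) * ((Rpowc (1 - s) q - 1) * RtoC ((1 - s) ^ S n)
        + RtoC ((1 - s) ^ S n - exp (- u))))%C.
    2: { unfold Beta_integrand, Gamma_integrand.
         replace (m - u) with (m * (1 - s)) by (unfold s; field; lra).
         rewrite Rpowc_mult_base by lra.
         replace (q + m + 1 - 1)%C with (q + m)%C by ring.
         assert (E1 : (Rpowc m (- (q + m)) * Rpowc m (q + m) = 1)%C)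
           by (rewrite <- Rpowc_plus; replace (- (q + m) + (q + m))%C with (RtoC 0) by ring;
               apply Rpowc_0).
         assert (E2 : Rpowc (1 - s) (q + m) = (Rpowc (1 - s) q * RtoC ((1 - s) ^ S n))%C).
         { rewrite Rpowc_plus. unfold m. rewrite Rpowc_INR by lra. rewrite RtoC_pow.
           reflexivity. }
         rewrite E2, RtoC_minus.
         transitivity (Rpowc u (p - 1) * (Rpowc m (- (q + m)) * Rpowc m (q + m)) *
           (Rpowc (1 - s) q * RtoC ((1 - s) ^ S n)) - Rpowc u (p - 1) * exp (- u))%C;
           [rewrite E1|]; ring. }
    rewrite Cmod_mult, Cmod_Rpowc, Re_minus. simpl (Re 1).
    assert (Hpow := Rpower_pos u (Re p - 1)).
    destruct (exp_pow_compare s (S n) ltac:(lra)) as [X1 X2]. rewrite Hms in X1, X2.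
    assert (X0 : 0 <= (1 - s) ^ S n) by (apply pow_le; lra).
    assert (X3 := Rpowc_near_1 q s ltac:(lra) Hs). fold A in X3.
    assert (He := exp_pos (- u)).
    apply Rle_trans with (Rpower u (Re p - 1) *
      (A * s * exp (- u) + INR (S n) * s ^ 2 * exp (- u))).
    + apply Rmult_le_compat_l; [lra|].
      eapply Rle_trans; [apply Cmod_triangle|]. rewrite Cmod_mult, !Cmod_R.
      apply Rplus_le_compat.
      * rewrite Rabs_pos_eq by exact X0.
        apply Rmult_le_compat; [apply Cmod_ge_0| exact X0| exact X3| lra].
      * rewrite Rabs_minus_sym, Rabs_pos_eq by exact X1. exact X2.
    + right. replace (Re p + 1 - 1) with ((Re p - 1) + 1) by ring.
      replace (Re p + 2 - 1) with ((Re p - 1) + 1 + 1) by ring.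
      rewrite !(Rpower_plus _ _ u), Rpower_1 by exact Hu0.
      unfold s. fold m. field. lra.
  - intros u Hu. rewrite Cmod_Gamma_integrand.
    assert (Hu0 : 0 < u) by lra.
    replace (Re p + 1 - 1) with ((Re p - 1) + 1) by ring.
    rewrite (Rpower_plus _ _ u), Rpower_1 by exact Hu0.
    assert (He := exp_pos (- u)). assert (Hpow := Rpower_pos u (Re p - 1)).
    assert (Hpow2 := Rpower_pos u (Re p + 2 - 1)).
    rewrite (Rmult_comm (/ m)).
    apply (Rle_div_r (Rpower u (Re p - 1) * exp (- u)) _ m); [lra|].
    assert (m <= A * u) by nra.
    assert (0 <= Rpower u (Re p - 1) * exp (- u)) by (apply Rmult_le_pos; lra).
    assert (0 <= Rpower u (Re p + 2 - 1) * exp (- u)) by (apply Rmult_le_pos; lra).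
    assert (0 <= Rpower u (Re p - 1) * exp (- u) * (A * u - m))
      by (apply Rmult_le_pos; lra).
    lra.
Qed.

Definition Cseq_lim (u : nat -> C) (l : C) : Prop :=
  is_lim_seq (fun n => Re (u n)) (Re l) /\ is_lim_seq (fun n => Im (u n)) (Im l).

Lemma Cseq_lim_bound u l (e : nat -> R) :
  (forall n, Cmod (u n - l)%C <= e n) -> is_lim_seq e 0 -> Cseq_lim u l.
Proof.
  intros H He.
  assert (E : forall p : C -> R, (forall z w, p (z - w)%C = p z - p w) ->
    (forall z, Rabs (p z) <= Cmod z) -> is_lim_seq (fun n => p (u n)) (p l)).
  { intros p Hp Hle. apply is_lim_seq_spec. intros eps.
    apply is_lim_seq_spec in He. generalize (He eps). apply filter_imp. intros n Hn.
    rewrite Rminus_0_r in Hn. apply Rabs_def2 in Hn. rewrite <- Hp.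
    eapply Rle_lt_trans; [apply Hle|]. specialize (H n). lra. }
  split; [apply (E Re)| apply (E Im)]; try reflexivity;
    [apply re_le_Cmod| apply Im_le_Cmod].
Qed.

Lemma Cseq_lim_mult u v l k : Cseq_lim u l -> Cseq_lim v k ->
  Cseq_lim (fun n => u n * v n)%C (l * k)%C.
Proof.
  intros [U1 U2] [V1 V2]; split.
  - apply is_lim_seq_minus'; apply is_lim_seq_mult'; assumption.
  - apply is_lim_seq_plus'; apply is_lim_seq_mult'; assumption.
Qed.

Lemma Cseq_lim_const c : Cseq_lim (fun _ => c) c.
Proof. split; apply is_lim_seq_const. Qed.

Lemma Cseq_lim_unique u v l k : (forall n, u n = v n) ->
  Cseq_lim u l -> Cseq_lim v k -> l = k.
Proof.
  intros E [U1 U2] [V1 V2].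
  assert (F : forall (a b : nat -> R) (x y : R), (forall n, a n = b n) ->
    is_lim_seq a x -> is_lim_seq b y -> x = y).
  { intros a b x y Eab Ha Hb. apply (is_lim_seq_ext _ _ _ Eab) in Ha.
    apply is_lim_seq_unique in Ha. apply is_lim_seq_unique in Hb. congruence. }
  apply C_ext; [eapply F; [|exact U1| exact V1]| eapply F; [|exact U2| exact V2]];
    intros n; cbv beta; rewrite E; reflexivity.
Qed.

Lemma inv_S_lim K : is_lim_seq (fun n => / INR (S n) * K) 0.
Proof.
  replace (Finite 0) with (Rbar_mult 0 K) by (simpl; f_equal; ring).
  apply is_lim_seq_scal_r.
  apply (is_lim_seq_incr_1 (fun n => / INR n)).
  apply (is_lim_seq_inv INR p_infty); [apply is_lim_seq_INR| discriminate].
Qed.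

Lemma Euler_limit p q : 0 < Re p -> 0 < Re q ->
  Cseq_lim (fun n => Rpowc (INR (S n)) p * Beta (q + INR (S n) + 1) p)%C (Gamma p).
Proof.
  intros Hp Hq. eapply Cseq_lim_bound; [|apply inv_S_lim].
  intros n. apply Beta_approx; assumption.
Qed.

Lemma Re_plus_INR z n : Re (z + INR n) = Re z + INR n.
Proof. reflexivity. Qed.

Lemma RtoC_neq_0 r : r <> 0 -> RtoC r <> 0.
Proof. intros H E. apply H, RtoC_inj, E. Qed.

Lemma Cmult_cancel_l (a z w : C) : (a * z = a * w)%C -> a <> 0 -> z = w.
Proof.
  intros H Ha. transitivity (/ a * (a * z))%C; [|rewrite H]; field; exact Ha.
Qed.

Lemma rising_neq_0 z n : 0 < Re z -> rising z n <> 0.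
Proof.
  intros Hz. induction n as [|n IH]; simpl rising.
  - intros H. injection H. lra.
  - apply Cmult_neq_0; [exact IH|]. apply Re_pos_neq_0.
    rewrite Re_plus_INR. generalize (pos_INR n). lra.
Qed.

Lemma INR_S_C n : RtoC (INR (S n)) = (INR n + 1)%C.
Proof. rewrite S_INR, RtoC_plus. reflexivity. Qed.

Lemma rising_shift z n : (z * rising (z + 1) n = rising z n * (z + INR n))%C.
Proof.
  induction n as [|n IH]; simpl rising; [simpl INR; ring|].
  rewrite INR_S_C, Cmult_assoc, IH. ring.
Qed.

Lemma Beta_shift p q n : 0 < Re p -> 0 < Re q ->
  (Beta (p + INR n) q * rising (p + q) n = rising p n * Beta p q)%C.
Proof.
  intros Hp Hq. induction n as [|n IH].
  - simpl. replace (p + 0)%C with p by ring. ring.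
  - simpl rising. rewrite INR_S_C, Cplus_assoc.
    assert (Hn : 0 < Re (p + INR n)) by (rewrite Re_plus_INR; generalize (pos_INR n); lra).
    generalize (Beta_S (p + INR n) q Hn Hq). intros H.
    transitivity (rising (p + q) n * ((p + INR n + q) * Beta (p + INR n + 1) q))%C; [ring|].
    rewrite H. transitivity ((p + INR n) * (Beta (p + INR n) q * rising (p + q) n))%C; [ring|].
    rewrite IH. ring.
Qed.

Lemma Cseq_lim_ratio z : Cseq_lim (fun n => / INR (S n) * (z + INR (S n)))%C 1.
Proof.
  apply (Cseq_lim_bound _ _ (fun n => / INR (S n) * Cmod z)); [|apply inv_S_lim].
  intros n. assert (H : 0 < INR (S n)) by (apply lt_0_INR; lia).
  assert (H0 : RtoC (INR (S n)) <> 0) by (apply RtoC_neq_0; lra).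
  replace (/ INR (S n) * (z + INR (S n)) - 1)%C with (/ INR (S n) * z)%C
    by (field; exact H0).
  rewrite Cmod_mult, Cmod_inv, Cmod_R, Rabs_pos_eq by (try exact H0; lra).
  apply Rle_refl.
Qed.

(** By [Beta_shift] the limits for Gamma(p) with parameter q, and for Gamma(q)
    and Gamma(p+q) with parameter 1, are limits of quotients of rising
    factorials.  In the identity the quotients cancel, up to the factors
    (z+1+m)/m that tend to 1. *)
Lemma Beta_Gamma p q : 0 < Re p -> 0 < Re q ->
  (Beta q p * Gamma (p + q) = Gamma p * Gamma q)%C.
Proof.
  intros Hp Hq.
  assert (Hpq : 0 < Re (p + q)) by (rewrite Re_plus; lra).
  assert (H1 : 0 < Re 1) by (simpl; lra).
  set (Y := fun z w n => (Rpowc (INR (S n)) z * Beta (w + INR (S n) + 1) z)%C).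
  set (W := fun z n => (/ INR (S n) * (z + 1 + INR (S n)))%C).
  eapply (Cseq_lim_unique (fun n => Beta q p * Y (p + q) 1 n * W (p + q) n)%C
    (fun n => Y p q n * Y q 1 n * W q n)%C).
  - intros n.
    set (m := INR (S n)). set (N := S (S n)).
    assert (HN : forall w, (w + m + 1 = w + INR N)%C)
      by (intros w; unfold m, N; rewrite (INR_S_C (S n)); ring).
    assert (HY : forall z w, 0 < Re z -> 0 < Re w ->
      (Y z w n * rising (w + z) N = Rpowc m z * (rising w N * Beta w z))%C).
    { intros z w Hz Hw. unfold Y. fold m. rewrite HN, <- (Beta_shift w z N Hw Hz). ring. }
    assert (HY1 : forall z, 0 < Re z ->
      (Y z 1 n * (rising z N * (z + INR N)) = Rpowc m z * rising 1 N)%C).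
    { intros z Hz. generalize (HY z 1%C Hz H1). rewrite Beta_1_l by exact Hz.
      intros E. rewrite <- rising_shift. rewrite (Cplus_comm z 1).
      transitivity (z * (Y z 1 n * rising (1 + z) N))%C; [ring|]. rewrite E.
      field. apply Re_pos_neq_0, Hz. }
    assert (HW : forall z, W z n = (/ m * (z + INR N))%C)
      by (intros z; unfold W; fold m; rewrite <- HN; ring).
    rewrite !HW.
    generalize (HY p q Hp Hq) (HY1 q Hq) (HY1 (p + q)%C Hpq).
    rewrite (Cplus_comm q p), (Rpowc_plus m p q).
    assert (R1 := rising_neq_0 q N Hq). assert (R2 := rising_neq_0 (p + q) N Hpq).
    set (r1 := rising q N) in *. set (r2 := rising (p + q) N) in *.
    set (F := rising 1 N). intros E1 E2 E3.
    apply (Cmult_cancel_l (r1 * r2)%C).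
    + transitivity (/ m * Beta q p * r1 * (Y (p + q)%C 1%C n * (r2 * (p + q + INR N))))%C;
        [ring|]. rewrite E3.
      transitivity (/ m * (Rpowc m p * (r1 * Beta q p)) * (Rpowc m q * F))%C; [ring|].
      rewrite <- E1, <- E2. ring.
    + apply Cmult_neq_0; assumption.
  - replace (Beta q p * Gamma (p + q))%C with (Beta q p * Gamma (p + q) * 1)%C by ring.
    apply Cseq_lim_mult; [apply Cseq_lim_mult; [apply Cseq_lim_const|]|].
    + apply Euler_limit; assumption.
    + apply Cseq_lim_ratio.
  - replace (Gamma p * Gamma q)%C with (Gamma p * Gamma q * 1)%C by ring.
    apply Cseq_lim_mult; [apply Cseq_lim_mult|].
    + apply Euler_limit; assumption.
    + apply Euler_limit; assumption.
    + apply Cseq_lim_ratio.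
Qed.

(** The Riemann-Liouville fractional integral of a power. *)
Lemma Cint_Beta_Gamma t p q : 0 < t -> 0 < Re p -> 0 < Re q ->
  Cint (Beta_integrand t p q) t
    (Rpowc t (p + q - 1) * (Gamma p * Gamma q * rGamma (p + q)))%C.
Proof.
  intros Ht Hp Hq.
  assert (Hpq : 0 < Re (p + q)) by (rewrite Re_plus; lra).
  replace (Gamma p * Gamma q * rGamma (p + q))%C with (Beta p q).
  { apply Cint_Beta_scaled; assumption. }
  rewrite rGamma_Re_pos by exact Hpq.
  rewrite (Cmult_comm (Gamma p)), <- (Beta_Gamma q p Hq Hp), (Cplus_comm q p).
  field. apply Gamma_neq_0, Hpq.
Qed.
(** * Fractional integration of Mittag-Leffler functions *)

Definition ML_term (a t : R) (x p : C) (j : nat) (u : R) : C :=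
  ((x * Rpower (t - u) a) ^ j * rGamma (p + a * INR j))%C.

Definition ML_majorant (a t : R) (x p : C) (j : nat) : R :=
  (Cmod x * Rpower t a) ^ j * Cmod (rGamma (p + a * INR j)).

Lemma ML_majorant_summable a t x p : 0 < a -> 0 < Re p -> ex_series (ML_majorant a t x p).
Proof.
  intros Ha Hp. apply rGamma_summable; [exact Hp| exact Ha|].
  apply Rmult_le_pos; [apply Cmod_ge_0| left; apply Rpower_pos].
Qed.

Lemma ML_term_le a t x p j u : 0 < a -> 0 < u < t ->
  Cmod (ML_term a t x p j u) <= ML_majorant a t x p j.
Proof.
  intros Ha Hu. unfold ML_term, ML_majorant. rewrite Cmod_mult, Cmod_pow, Cmod_mult, Cmod_R.
  apply Rmult_le_compat_r; [apply Cmod_ge_0|]. assert (Hp := Rpower_pos (t - u) a).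
  rewrite Rabs_pos_eq by lra. apply pow_incr. split.
  - apply Rmult_le_pos; [apply Cmod_ge_0| lra].
  - apply Rmult_le_compat_l; [apply Cmod_ge_0|]. apply Rle_Rpower_l; lra.
Qed.

Lemma ML_term_cont a t x p j u : u < t -> Ccont (ML_term a t x p j) u.
Proof.
  intros Hu. apply Ccont_mult; [|apply Ccont_const].
  apply Ccont_pow, Ccont_mult; [apply Ccont_const|]. apply Ccont_RtoC.
  apply (ex_derive_continuous (V := R_NormedModule)). unfold Rpower. auto_derive. lra.
Qed.

Lemma Beta_integrand_shift_l t p q (a : R) j u : u < t ->
  Beta_integrand t (p + a * INR j) q u =
  (Beta_integrand t p q u * RtoC (Rpower (t - u) a) ^ j)%C.
Proof.
  intros Hu. unfold Beta_integrand.
  replace (p + a * INR j - 1)%C with (p - 1 + RtoC (a * INR j))%C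
    by (rewrite RtoC_mult; ring).
  rewrite Rpowc_plus, Rpowc_RtoC, <- Rpower_mult, Rpower_pow by apply Rpower_pos.
  rewrite RtoC_pow. ring.
Qed.

(** The Mittag-Leffler series is integrated term by term, each term being a
    fractional integral of a power. *)
Lemma Cint_ML a t x p q : 0 < a -> 0 < t -> 0 < Re p -> 0 < Re q ->
  Cint (fun u => Beta_integrand t p q u *
      MittagLeffler a p (x * Rpower (t - u) a))%C t
    (Rpowc t (p + q - 1) * Gamma q * MittagLeffler a (p + q) (x * Rpower t a))%C.
Proof.
  intros Ha Ht Hp Hq.
  destruct (Rint_Beta_scaled_ex t (Re p) (Re q) Ht Hp Hq) as [D HD].
  set (c := (Rpowc t (p + q - 1) * Gamma q)%C).
  assert (Hc : c <> 0)
    by (apply Cmult_neq_0; [apply Rpowc_neq_0| apply Gamma_neq_0, Hq]).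
  (* All terms share the nonzero factor c; dividing it out shows that the
     Mittag-Leffler series at the upper parameter converges. *)
  destruct (Cint_series (Beta_integrand t p q) (ML_term a t x p)
    (fun u => Rpower (t - u) (Re p - 1) * Rpower u (Re q - 1)) (ML_majorant a t x p)
    t D (fun j => c * ((x * Rpower t a) ^ j * rGamma (p + q + a * INR j)))%C Ht)
    as (L & HL & HI).
  - intros u Hu. apply Beta_integrand_cont, Hu.
  - intros u _. apply Req_le, Cmod_Beta_integrand.
  - exact HD.
  - intros j u [_ Hu]. apply ML_term_cont, Hu.
  - intros j u Hu. apply ML_term_le; [exact Ha| exact Hu].
  - apply ML_majorant_summable; assumption.
  - intros j.
    assert (Hpj : 0 < Re (p + a * INR j)).
    { rewrite Re_plus, re_mult. simpl. assert (Hj := pos_INR j). nra. }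
    eapply Cint_replace; [exact Ht| | |
      exact (Cint_scal (x ^ j * rGamma (p + a * INR j))%C _ t _ Ht
        (Cint_Beta_Gamma t _ q Ht Hpj Hq))].
    + intros u [_ Hu]. simpl in Hu. cbv beta.
      rewrite Beta_integrand_shift_l by exact Hu.
      unfold ML_term. rewrite Cpow_mult_l. ring.
    + unfold c. rewrite (rGamma_Re_pos (p + a * INR j)) by exact Hpj.
      replace (p + a * INR j + q)%C with (p + q + a * INR j)%C by ring.
      replace (p + q + a * INR j - 1)%C with (p + q - 1 + RtoC (a * INR j))%C
        by (rewrite RtoC_mult; ring).
      rewrite Rpowc_plus, Rpowc_RtoC, <- Rpower_mult, Rpower_pow by apply Rpower_pos.
      rewrite RtoC_pow, Cpow_mult_l. field. apply Gamma_neq_0, Hpj.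
  - replace (c * MittagLeffler a (p + q) (x * Rpower t a))%C with L; [exact HI|].
    assert (HS : is_series (V := C_NormedModule)
      (fun j => ((x * Rpower t a) ^ j * rGamma (p + q + a * INR j))%C) (/ c * L)%C).
    { refine (is_series_ext _ _ _ _ (is_series_C_scal (/ c) _ _ HL)).
      intros j. match goal with |- @eq _ ?y ?z => change (@eq C y z) end. field. exact Hc. }
    unfold MittagLeffler. rewrite (CSeries_unique _ _ HS). field. exact Hc.
Qed.

Lemma term_le_Series (M : nat -> R) n : (forall k, 0 <= M k) -> ex_series M ->
  M n <= Series M.
Proof.
  intros H0 HM. apply Rle_trans with (sum_n M n).
  - destruct n as [|n]; [rewrite sum_O; lra|]. rewrite sum_Sn. unfold plus; simpl.
    assert (0 <= sum_n M n); [|lra].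
    induction n as [|n IH]; [rewrite sum_O; apply H0|].
    rewrite sum_Sn. unfold plus; simpl. specialize (H0 (S n)). lra.
  - apply (is_lim_seq_incr_compare (sum_n M)); [apply (Series_correct M HM)|].
    intros k. rewrite sum_Sn. unfold plus; simpl. specialize (H0 (S k)). lra.
Qed.

(** Division by Gamma(beta+k) makes a series with positive radius of
    convergence entire: at a radius r inside the disk the quotients (t/r)^k
    are absorbed by the reciprocal Gamma function. *)
Lemma Borel_summable (f : nat -> C) (t : R) (beta : C) :
  Rbar_lt 0 (CV_radius (fun k => Cmod (f k))) -> 0 < t -> 0 < Re beta ->
  ex_series (fun k => Cmod (f k) * (t ^ k * Cmod (rGamma (beta + INR k)))).
Proof.
  intros Hf Ht Hb.
  assert (exists r, 0 < r /\ Rbar_lt r (CV_radius (fun k => Cmod (f k)))) as (r & Hr & Hr2).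
  { destruct (CV_radius (fun k => Cmod (f k))) as [c| |]; simpl in *.
    - exists (c / 2). lra.
    - exists 1. split; [lra| exact I].
    - tauto. }
  assert (Hq : 0 <= t / r) by (left; apply Rdiv_lt_0_compat; assumption).
  assert (HM := rGamma_summable beta 1 (t / r) Hb Rlt_0_1 Hq).
  set (M := fun k => (t / r) ^ k * Cmod (rGamma (beta + 1 * INR k))) in *.
  assert (HM0 : forall k, 0 <= M k)
    by (intros k; apply Rmult_le_pos; [apply pow_le, Hq| apply Cmod_ge_0]).
  assert (Hs : ex_series (fun k => r ^ k * Cmod (f k))).
  { eapply ex_series_ext; [|apply (CV_radius_inside (fun k => Cmod (f k)) r)].
    - intros k. rewrite pow_n_pow. reflexivity.
    - rewrite Rabs_pos_eq by lra. exact Hr2. }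
  apply (ex_series_le (V := R_CompleteNormedModule) _
    (fun k => Series M * (r ^ k * Cmod (f k)))).
  2: exact (ex_series_scal_l (V := R_NormedModule) (Series M) _ Hs).
  intros k. unfold norm; simpl; unfold abs; simpl.
  assert (Hfk := Cmod_ge_0 (f k)). assert (Hrk := pow_lt r k Hr).
  rewrite Rabs_pos_eq.
  2: { apply Rmult_le_pos; [lra|]. apply Rmult_le_pos; [apply pow_le; lra| apply Cmod_ge_0]. }
  assert (HMk := term_le_Series M k HM0 HM).
  replace (Cmod (f k) * (t ^ k * Cmod (rGamma (beta + INR k))))
    with (M k * (r ^ k * Cmod (f k))).
  - apply Rmult_le_compat_r; [apply Rmult_le_pos; lra| exact HMk].
  - unfold M. rewrite Cmult_1_l. unfold Rdiv. rewrite Rpow_mult_distr, pow_inv.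
    field. lra.
Qed.

Theorem mainTheorem13 (f : nat -> C) (a t : R) (x b beta : C)
  (hf : Rbar_lt 0 (CV_radius (fun k : nat => Cmod (f k))))
  (ha : 0 < a) (ht : 0 < t)
  (hbeta : 0 < Re beta) (hb : Re beta < Re b) :
  let lhs : nat -> C := fun k : nat =>
    (f k * Rpowc t (b + INR k - 1)
       * MittagLeffler a (b + INR k) (x * Rpower t a))%C in
  let inner : R -> nat -> C := fun (u : R) (k : nat) =>
    (f k * (RtoC u ^ k * rGamma (beta + INR k)))%C in
  let integrand : R -> C := fun u : R =>
    (Rpowc (t - u) (b - beta - 1)
       * MittagLeffler a (b - beta) (x * Rpower (t - u) a)
       * Rpowc u (beta - 1)
       * CSeries (inner u))%C in
  ex_series (V := C_NormedModule) lhs /\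
  (forall u : R, 0 < u < t -> ex_series (V := C_NormedModule) (inner u)) /\
  ex_RInt_gen (V := C_R_NormedModule) integrand (at_right 0) (at_left t) /\
  CSeries lhs =
    RInt_gen (V := C_R_CompleteNormedModule) integrand (at_right 0) (at_left t).
Proof.
  intros lhs inner integrand.
  set (p := (b - beta)%C) in *.
  assert (Hp : 0 < Re p) by (unfold p; rewrite Re_minus; lra).
  set (N := fun k => Cmod (f k) * (t ^ k * Cmod (rGamma (beta + INR k)))).
  assert (HN : ex_series N) by (apply Borel_summable; assumption).
  assert (Hinner : forall k u, 0 < u < t -> Cmod (inner u k) <= N k).
  { intros k u Hu. unfold inner, N. rewrite !Cmod_mult, Cmod_pow, Cmod_R.
    apply Rmult_le_compat_l; [apply Cmod_ge_0|].
    apply Rmult_le_compat_r; [apply Cmod_ge_0|].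
    rewrite Rabs_pos_eq by lra. apply pow_incr. lra. }
  set (E := fun u => MittagLeffler a p (x * Rpower (t - u) a)).
  set (w := fun u => (Beta_integrand t p beta u * E u)%C).
  destruct (Rint_Beta_scaled_ex t (Re p) (Re beta) ht Hp hbeta) as [D HD].
  (* The first series, already summed, is bounded by S and becomes part of the
     weight for the second one. *)
  set (S := Series (ML_majorant a t x p)).
  assert (HS := ML_majorant_summable a t x p ha Hp).
  destruct (Cint_series w (fun k u => inner u k)
    (fun u => S * (Rpower (t - u) (Re p - 1) * Rpower u (Re beta - 1)))
    N t (S * D) lhs ht) as (L & HL & HI).
  - intros u Hu. apply Ccont_mult; [apply Beta_integrand_cont, Hu|].
    apply (Ccont_CSeries (ML_term a t x p) (ML_majorant a t x p) t u);
      [|intros j v Hv; apply ML_term_le; [exact ha| exact Hv]| exact HS| exact Hu].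
    intros j v [_ Hv]. apply ML_term_cont, Hv.
  - intros u Hu. unfold w. rewrite Cmod_mult, Cmod_Beta_integrand, Rmult_comm.
    apply Rmult_le_compat_r; [apply Rmult_le_pos; left; apply Rpower_pos|].
    apply (Weierstrass_bound (fun j => ML_term a t x p j u)); [|exact HS].
    intros j. apply ML_term_le; [exact ha| exact Hu].
  - apply Rint_scal, HD.
  - intros k u _. unfold inner.
    apply Ccont_mult; [apply Ccont_const|]. apply Ccont_mult; [|apply Ccont_const].
    apply Ccont_pow, Ccont_RtoC, continuous_id.
  - intros k u Hu. apply Hinner, Hu.
  - exact HN.
  - intros k.
    assert (Hk : 0 < Re (beta + INR k)) by (rewrite Re_plus_INR; generalize (pos_INR k); lra).
    eapply Cint_replace; [exact ht| | |
      exact (Cint_scal (f k * rGamma (beta + INR k))%C _ t _ ht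
        (Cint_ML a t x p (beta + INR k) ha ht Hp Hk))].
    + intros u [Hu _]. unfold w, E, inner, Beta_integrand.
      replace (beta + INR k - 1)%C with (beta - 1 + INR k)%C by ring.
      rewrite Rpowc_plus, Rpowc_INR by exact Hu. ring.
    + unfold lhs. rewrite rGamma_Re_pos by exact Hk.
      replace (p + (beta + INR k))%C with (b + INR k)%C by (unfold p; ring).
      field. apply Gamma_neq_0, Hk.
  - assert (HJ : Cint integrand t L).
    { eapply Cint_ext; [exact ht| |exact HI]. intros u _.
      unfold w, E, integrand, Beta_integrand.
      change (fun k => inner u k) with (inner u). fold p. ring. }
    split; [|split; [|split]].
    + exists L. exact HL.
    + intros u Hu. eexists.
      apply (Weierstrass_test (inner u) N); [intros k; apply Hinner, Hu| exact HN].
    + exists L. exact HJ.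
    + rewrite (CSeries_unique lhs L HL). symmetry.
      exact (is_RInt_gen_unique (V := C_R_CompleteNormedModule)
        (Fa := at_right 0) (Fb := at_left t) integrand L HJ).
Qed.
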